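(* Let $f\colon\operatorname{Spec}S\to\operatorname{Spec}R$ be a finite dominant morphism, where $R$ and $S$ are Cohen--Macaulay $F$-finite noetherian $\mathbb{F}_p$-algebras admitting canonical modules, satisfying $\mathbf{G}_1+\mathbf{S}_2$ and property $(!)$, and let $T\in\operatorname{Hom}_R(S,R)$ be such that $S\to\operatorname{Hom}_R(S,R)$, $1\mapsto T$, is a generic isomorphism. Then $$\operatorname{Tr}_{\omega_R}\big(f_*\tau(\omega_S,\kappa_S)\big)=\tau(\omega_R,\kappa_R).$$ In particular, $\operatorname{Tr}_{\omega_R}\colon f_*\omega_S\to\omega_R$ is surjective if $R$ is $F$-rational. Conversely, if $\operatorname{Tr}_{\omega_R}\colon f_*\omega_S\to\omega_R$ is surjective and $S$ is $F$-rational, then $R$ is $F$-rational.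
   Context: $\mathbf{G}_1$: local rings at points of codimension $\le1$ are Gorenstein; $\mathbf{S}_2$ is Serre's condition. ''Generic isomorphism'': an isomorphism after tensoring over $R$ with the total ring of fractions of $R$. Canonical modules are chosen compatibly: $\omega_S=f^!\omega_R=\operatorname{Hom}_R(S,\omega_R)$; $\operatorname{Tr}_{\omega_R}\colon f_*\omega_S\to\omega_R$ is evaluation at $1$. Property $(!)$: $F^!\omega_R\cong\omega_R$, where $F^!=\operatorname{Hom}_R(F_*R,-)$ (similarly for $S$). The Cartier operator $\kappa_R\colon F_*\omega_R\to\omega_R$ is the map corresponding to $1$ under the resulting isomorphism $\operatorname{Hom}_R(F_*\omega_R,\omega_R)\cong R$, so $\kappa_R\cdot R=\operatorname{Hom}_R(F_*\omega_R,\omega_R)$ (right multiplication is pre-multiplication). $\kappa_S=\kappa_R^!\colon F_*\omega_S\to\omega_S$ is given by $\kappa_S(F_*\mu)(s)=\kappa_R(F_*\mu(s^p))$. A Cartier $R$-algebra is an $\mathbb{N}$-graded ring $\mathcal{C}=\bigoplus_e\mathcal{C}_e$ with $\mathcal{C}_0=R$ and $r\kappa=\kappa r^{p^e}$ for $\kappa\in\mathcal{C}_e$; $\mathcal{C}_+=\bigoplus_{e\ge1}\mathcal{C}_e$. A Cartier $\mathcal{C}$-module is a left $\mathcal{C}$-module finitely generated over $R$. A morphism is a nil-isomorphism if kernel and cokernel are killed by a power of $\mathcal{C}_+$. The test module $\tau(M,\mathcal{C})$ is the smallest Cartier submodule $N\subset M$ such that $H^0_\eta(N_\eta)\to H^0_\eta(M_\eta)$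 ($\eta$-power torsion of the localizations) is a nil-isomorphism for all $\eta\in\operatorname{Ass}M$. $(\omega_R,\kappa_R)$ denotes $\omega_R$ as a Cartier module over its full Cartier algebra $\bigoplus_e\operatorname{Hom}_R(F^e_*\omega_R,\omega_R)$ (degree $0$ part replaced by $R$), which is generated by $\kappa_R$; similarly for $(\omega_S,\kappa_S)$. $R$ (Cohen--Macaulay with $(!)$) is $F$-rational if $\tau(\omega_R,\kappa_R)=\omega_R$; similarly for $S$. *)

(* Defs.v *)
From HB Require Import structures.
From mathcomp Require Import all_boot all_order all_algebra ring_quotient.
From mathcomp Require Import generic_quotient.
From mathcomp Require Import boolp classical_sets ring.

Set Implicit Arguments.
Unset Strict Implicit.
Unset Printing Implicit Defensive.

Import GRing.Theory.
Local Open Scope classical_set_scope.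
Local Open Scope ring_scope.
Local Open Scope quotient_scope.

(* Rings are commutative and nonzero ([comNzRingType]), modules are
   [lmodType]s, and a ring viewed as a module over itself is [R^o].  The
   spectrum of a ring is the library's type [prime_idealr R]; membership in a
   prime ideal is boolean, which is no restriction classically. *)

(** * Finite generation *)

Definition span (A : comNzRingType) (M : lmodType A) (s : seq M) : set M :=
  [set m | exists c : nat -> A, m = \sum_(i < size s) c i *: s`_i].

Definition fin_gen (A : comNzRingType) (M : lmodType A) : Prop :=
  exists s : seq M, forall m, span s m.

(* [idealr A] is the type of proper ideals; the unit ideal is generated by 1. *)
Definition noetherian (A : comNzRingType) : Prop :=
  forall I : idealr A, exists s : seq A^o, forall x : A, x \in I <-> span s x.

(** * Restriction of scalars and its right adjoint *)

(* [f_* M]: the B-module M with A acting through f. *)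
Definition pushforward (A B : comNzRingType) (f : {rmorphism A -> B})
  (M : lmodType B) : Type := M.

Section Pushforward.
Variables (A B : comNzRingType) (f : {rmorphism A -> B}) (M : lmodType B).

HB.instance Definition _ := GRing.Zmodule.copy (pushforward f M) M.

Definition pushforward_scale (a : A) (m : pushforward f M) : pushforward f M :=
  f a *: (m : M).

Fact pushforward_scaleA a b m :
  pushforward_scale a (pushforward_scale b m) = pushforward_scale (a * b) m.
Proof. by rewrite /pushforward_scale scalerA rmorphM. Qed.

Fact pushforward_scale1 : left_id 1 pushforward_scale.
Proof. by move=> m; rewrite /pushforward_scale rmorph1 scale1r. Qed.

Fact pushforward_scaleDr : right_distributive pushforward_scale +%R.
Proof. by move=> a m n; rewrite /pushforward_scale scalerDr. Qed.

Fact pushforward_scaleDl m :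
  {morph pushforward_scale^~ m : a b / a + b}.
Proof. by move=> a b; rewrite /pushforward_scale rmorphD scalerDl. Qed.

HB.instance Definition _ := GRing.Zmodule_isLmodule.Build A (pushforward f M)
  pushforward_scaleA pushforward_scale1 pushforward_scaleDr
  pushforward_scaleDl.

End Pushforward.

Section Shriek.
Variables (A B : comNzRingType) (f : {rmorphism A -> B}) (W : lmodType A).

(* [f^! W = Hom_A(f_* B, W)], with B acting by premultiplication. *)
Definition shriek : Type := {linear pushforward f B^o -> W}.

Definition shriek_fun (g : shriek) : B -> W :=
  fun x => (g : {linear pushforward f B^o -> W}) x.
Coercion shriek_fun : shriek >-> Funclass.

HB.instance Definition _ := gen_eqMixin shriek.
HB.instance Definition _ := gen_choiceMixin shriek.

Lemma shriek_ext (g h : shriek) : (forall x, g x = h x) -> g = h.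
Proof.
case: g h => [g [[gD] [gZ]]] [h [[hD] [hZ]]] e.
have {}e : g = h by apply/funext => x; exact: (e x).
subst h.
by rewrite (Prop_irrelevance gD hD) (Prop_irrelevance gZ hZ).
Qed.

Lemma shriekD (g : shriek) x y : g (x + y) = g x + g y.
Proof. exact: (raddfD (g : {linear pushforward f B^o -> W})). Qed.

Lemma shriekZ (g : shriek) a x : g (f a * x) = a *: g x.
Proof. exact: (linearZ_LR (g : {linear pushforward f B^o -> W})). Qed.

Section Mk.
Variables (g : B -> W) (gD : {morph g : x y / x + y})
  (gZ : forall a x, g (f a * x) = a *: g x).

Let g' : pushforward f B^o -> W := g.

Fact mk_shriek_linear : linear g'.
Proof.
move=> a x y; have -> : a *: x + y = f a * (x : B) + (y : B) :> B by [].
by rewrite /g' gD gZ.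
Qed.

HB.instance Definition _ :=
  GRing.isLinear.Build A (pushforward f B^o) W *:%R g' mk_shriek_linear.

Definition mk_shriek : shriek := g' : {linear pushforward f B^o -> W}.

End Mk.

Definition shriek0 : shriek.
Proof.
apply: (@mk_shriek (fun=> 0)) => [x y|a x]; first by rewrite addr0.
by rewrite scaler0.
Defined.

Definition shriek_opp (g : shriek) : shriek.
Proof.
apply: (@mk_shriek (fun x => - g x)) => [x y|a x] /=.
  by rewrite shriekD opprD.
by rewrite shriekZ scalerN.
Defined.

Definition shriek_add (g h : shriek) : shriek.
Proof.
apply: (@mk_shriek (fun x => g x + h x)) => [x y|a x].
  by rewrite !shriekD addrACA.
by rewrite !shriekZ scalerDr.
Defined.

Definition shriek_scale (b : B) (g : shriek) : shriek.
Proof.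
apply: (@mk_shriek (fun x => g (b * x))) => [x y|a x].
  by rewrite mulrDr shriekD.
by rewrite mulrCA shriekZ.
Defined.

Fact shriek_addA : associative shriek_add.
Proof. by move=> g h k; apply: shriek_ext => x; apply: addrA. Qed.
Fact shriek_addC : commutative shriek_add.
Proof. by move=> g h; apply: shriek_ext => x; apply: addrC. Qed.
Fact shriek_add0 : left_id shriek0 shriek_add.
Proof. by move=> g; apply: shriek_ext => x; apply: add0r. Qed.
Fact shriek_addN : left_inverse shriek0 shriek_opp shriek_add.
Proof. by move=> g; apply: shriek_ext => x; apply: addNr. Qed.

HB.instance Definition _ := GRing.isZmodule.Build shriek
  shriek_addA shriek_addC shriek_add0 shriek_addN.

Fact shriek_scaleA a b g :
  shriek_scale a (shriek_scale b g) = shriek_scale (a * b) g.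
Proof.
by apply: shriek_ext => x; rewrite [LHS]/(g (b * (a * x))) mulrA [b * a]mulrC.
Qed.
Fact shriek_scale1 : left_id 1 shriek_scale.
Proof. by move=> g; apply: shriek_ext => x; rewrite [LHS]/(g (1 * x)) mul1r. Qed.
Fact shriek_scaleDr : right_distributive shriek_scale +%R.
Proof. by move=> b g h; apply: shriek_ext. Qed.
Fact shriek_scaleDl g : {morph shriek_scale^~ g : a b / a + b}.
Proof.
move=> a b; apply: shriek_ext => x.
have -> : shriek_scale (a + b) g x = g ((a + b) * x) by [].
by rewrite mulrDl shriekD.
Qed.

HB.instance Definition _ := GRing.Zmodule_isLmodule.Build B shriek
  shriek_scaleA shriek_scale1 shriek_scaleDr shriek_scaleDl.

(* The trace [f_* f^! W -> W]. *)
Definition Tr (g : shriek) : W := g 1.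

End Shriek.

(** * Localization *)

Record mulset (A : comNzRingType) := MulSet {
  mset :> set A;
  mset1 : mset 1;
  msetM : forall s t, mset s -> mset t -> mset (s * t);
  mset0 : ~ mset 0
}.

Section LocModule.
Variables (A : comNzRingType) (W : mulset A) (M : lmodType A).

Definition denom : Type := {s : A | s \in mset W}.

HB.instance Definition _ := Choice.on denom.

Definition dval (s : denom) : A := val s.

Lemma denomP (s : denom) : mset W (dval s).
Proof. exact: set_mem (valP s). Qed.

Definition loc_rel (x y : M * denom) : bool :=
  `[< exists2 u : A, mset W u &
      u *: (dval y.2 *: x.1) = u *: (dval x.2 *: y.1) >].

Fact loc_rel_refl : reflexive loc_rel.
Proof. by move=> x; apply/asboolP; exists 1 => //; exact: mset1. Qed.

Fact loc_rel_sym : symmetric loc_rel.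
Proof. by move=> x y; apply/asboolP/asboolP => -[u Wu e]; exists u. Qed.

Fact loc_rel_trans : transitive loc_rel.
Proof.
move=> [n t] [m s] [k r] /asboolP[u Wu /= e1] /asboolP[v Wv /= e2].
apply/asboolP; exists (u * v * dval t).
  by apply: msetM; [apply: msetM | exact: denomP].
transitivity ((v * dval r) *: (u *: (dval t *: m))).
  by rewrite /= !scalerA; congr (_ *: _); ring.
rewrite e1; transitivity ((u * dval s) *: (v *: (dval r *: n))).
  by rewrite !scalerA; congr (_ *: _); ring.
by rewrite e2 /= !scalerA; congr (_ *: _); ring.
Qed.

Canonical loc_equiv := EquivRel loc_rel loc_rel_refl loc_rel_sym loc_rel_trans.

(* [W^-1 M], which is M tensored over A with [W^-1 A]. *)
Definition loc_mod : Type := {eq_quot loc_equiv}.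

HB.instance Definition _ := Choice.on loc_mod.

Definition frac (m : M) (s : denom) : loc_mod := \pi_{eq_quot loc_equiv} (m, s).

Lemma fracP m s n t :
  frac m s = frac n t <->
  exists2 u, mset W u & u *: (dval t *: m) = u *: (dval s *: n).
Proof.
rewrite /frac; split=> [/eqP|h].
  by rewrite eqmodE => /asboolP.
by apply/eqP; rewrite eqmodE; apply/asboolP.
Qed.

Definition loc_num (x : loc_mod) : M :=
  (repr (x : {eq_quot loc_equiv})).1.
Definition loc_den (x : loc_mod) : denom :=
  (repr (x : {eq_quot loc_equiv})).2.

Lemma fracK x : frac (loc_num x) (loc_den x) = x.
Proof. by rewrite /frac /loc_num /loc_den -surjective_pairing; exact: reprK. Qed.

Lemma fracW x : exists m s, x = frac m s.
Proof. by exists (loc_num x), (loc_den x); rewrite fracK. Qed.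

Lemma loc_numP m s : exists2 u, mset W u &
  u *: (dval s *: loc_num (frac m s)) = u *: (dval (loc_den (frac m s)) *: m).
Proof. by apply/fracP; rewrite fracK. Qed.

End LocModule.

Section Denom.
Variables (A : comNzRingType) (W : mulset A).

Definition mk_denom (s : A) (Ws : mset W s) : denom W := exist _ s (mem_set Ws).

Definition denom1 : denom W := mk_denom (mset1 W).

Definition denomM (s t : denom W) : denom W :=
  mk_denom (msetM (denomP s) (denomP t)).

Lemma val_denomM s t : dval (denomM s t) = dval s * dval t. Proof. by []. Qed.

Lemma val_denom1 : dval denom1 = 1. Proof. by []. Qed.

End Denom.

Section LocZmod.
Variables (A : comNzRingType) (W : mulset A) (M : lmodType A).
Local Notation LM := (loc_mod W M).

Definition loc_zero : LM := frac 0 (denom1 W).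

Definition loc_opp (x : LM) : LM := frac (- loc_num x) (loc_den x).

Definition loc_add (x y : LM) : LM :=
  frac (dval (loc_den y) *: loc_num x + dval (loc_den x) *: loc_num y)
    (denomM (loc_den x) (loc_den y)).

Lemma loc_oppE (m : M) (s : denom W) : loc_opp (frac m s) = frac (- m) s.
Proof.
apply/fracP; have [u Wu e] := loc_numP m s; exists u => //.
by rewrite !scalerN e.
Qed.

Lemma loc_addE (m n : M) (s t : denom W) : loc_add (frac m s) (frac n t) =
  frac (dval t *: m + dval s *: n) (denomM s t).
Proof.
apply/fracP; have [u Wu e] := loc_numP m s; have [v Wv e'] := loc_numP n t.
move: (loc_num _) (loc_den _) e => m' s' e.
move: (loc_num _) (loc_den _) e' => n' t' e'.
exists (u * v); first exact: msetM.
rewrite !val_denomM !scalerDr; congr (_ + _).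
  transitivity ((v * dval t * dval t') *: (u *: (dval s *: m'))).
    by rewrite !scalerA; congr (_ *: _); ring.
  by rewrite e !scalerA; congr (_ *: _); ring.
transitivity ((u * dval s * dval s') *: (v *: (dval t *: n'))).
  by rewrite !scalerA; congr (_ *: _); ring.
by rewrite e' !scalerA; congr (_ *: _); ring.
Qed.

Lemma frac_cancel (m n : M) (s t : denom W) :
  dval t *: m = dval s *: n -> frac m s = frac n t.
Proof. by move=> e; apply/fracP; exists 1; [exact: mset1 | rewrite e]. Qed.

Fact loc_addA : associative loc_add.
Proof.
move=> x y z; have [m [s ->]] := fracW x; have [n [t ->]] := fracW y.
have [k [r ->]] := fracW z; rewrite !loc_addE; apply: frac_cancel.
rewrite !val_denomM !scalerDr !scalerA addrA.
by congr (_ *: _ + _ *: _ + _ *: _); ring.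
Qed.

Fact loc_addC : commutative loc_add.
Proof.
move=> x y; have [m [s ->]] := fracW x; have [n [t ->]] := fracW y.
rewrite !loc_addE; apply: frac_cancel.
rewrite !val_denomM !scalerDr !scalerA addrC.
by congr (_ *: _ + _ *: _); ring.
Qed.

Fact loc_add0 : left_id loc_zero loc_add.
Proof.
move=> x; have [m [s ->]] := fracW x; rewrite loc_addE; apply: frac_cancel.
by rewrite val_denomM val_denom1 scaler0 add0r scale1r mul1r.
Qed.

Fact loc_addN : left_inverse loc_zero loc_opp loc_add.
Proof.
move=> x; have [m [s ->]] := fracW x; rewrite loc_oppE loc_addE.
by apply: frac_cancel; rewrite scalerN addNr !scaler0.
Qed.

HB.instance Definition _ := GRing.isZmodule.Build LM
  loc_addA loc_addC loc_add0 loc_addN.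

Lemma fracD (m n : M) (s t : denom W) :
  frac m s + frac n t = frac (dval t *: m + dval s *: n) (denomM s t).
Proof. exact: loc_addE. Qed.

End LocZmod.

Section LocRing.
Variables (A : comNzRingType) (W : mulset A).

Definition loc_act (M : lmodType A) (a : loc_mod W A^o) (x : loc_mod W M) :
    loc_mod W M :=
  frac ((loc_num a : A) *: loc_num x) (denomM (loc_den a) (loc_den x)).

Lemma loc_actE (M : lmodType A) (a : A) (m : M) (s t : denom W) :
  loc_act (frac (a : A^o) s) (frac m t) = frac (a *: m) (denomM s t).
Proof.
apply/fracP; have [u Wu e] := loc_numP (a : A^o) s.
have [v Wv e'] := loc_numP m t.
move: (loc_num _) (loc_den _) e => a' s' e.
move: (loc_num _) (loc_den _) e' => m' t' e'.
have {}e : u * (dval s * (a' : A)) = u * (dval s' * a) := e.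
exists (u * v); first exact: msetM.
rewrite !val_denomM.
transitivity ((u * (dval s * (a' : A))) *: (v *: (dval t *: m'))).
  by rewrite !scalerA; congr (_ *: _); ring.
by rewrite e e' !scalerA; congr (_ *: _); ring.
Qed.

(* [W^-1 A] *)
Definition loc_ring : Type := loc_mod W A^o.

HB.instance Definition _ := GRing.Zmodule.copy loc_ring (loc_mod W A^o).

Definition rfrac (a : A) (s : denom W) : loc_ring := frac (a : A^o) s.

Definition loc_one : loc_ring := rfrac 1 (denom1 W).

Definition loc_mul (a b : loc_ring) : loc_ring := loc_act a b.

Lemma rfracW (x : loc_ring) : exists a s, x = rfrac a s.
Proof. by have [a [s e]] := fracW (x : loc_mod W A^o); exists a, s. Qed.

Lemma rfrac_cancel (a b : A) (s t : denom W) :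
  dval t * a = dval s * b -> rfrac a s = rfrac b t.
Proof. by move=> e; apply: (@frac_cancel _ _ A^o). Qed.

Lemma loc_mulE a b s t :
  loc_mul (rfrac a s) (rfrac b t) = rfrac (a * b) (denomM s t).
Proof. exact: (@loc_actE A^o). Qed.

Lemma rfracD (a b : A) (s t : denom W) :
  rfrac a s + rfrac b t = rfrac (dval t * a + dval s * b) (denomM s t).
Proof. exact: (@fracD _ _ A^o). Qed.

Fact loc_mulA : associative loc_mul.
Proof.
move=> x y z; have [a [s ->]] := rfracW x; have [b [t ->]] := rfracW y.
have [c [r ->]] := rfracW z; rewrite !loc_mulE; apply: rfrac_cancel.
by rewrite !val_denomM; ring.
Qed.

Fact loc_mulC : commutative loc_mul.
Proof.
move=> x y; have [a [s ->]] := rfracW x; have [b [t ->]] := rfracW y.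
by rewrite !loc_mulE; apply: rfrac_cancel; rewrite !val_denomM; ring.
Qed.

Fact loc_mul1 : left_id loc_one loc_mul.
Proof.
move=> x; have [a [s ->]] := rfracW x.
by rewrite loc_mulE; apply: rfrac_cancel; rewrite val_denomM val_denom1; ring.
Qed.

Fact loc_mulDl : left_distributive loc_mul +%R.
Proof.
move=> x y z; have [a [s ->]] := rfracW x; have [b [t ->]] := rfracW y.
have [c [r ->]] := rfracW z; rewrite !(loc_mulE, rfracD).
by apply: rfrac_cancel; rewrite !val_denomM; ring.
Qed.

Fact loc_one_neq0 : loc_one != 0.
Proof.
apply/eqP => /fracP [u Wu].
rewrite !scaler0 val_denom1 scale1r => e; apply: (@mset0 _ W).
suff -> : 0 = u by [].
by rewrite -e -[LHS]/(u * 1) mulr1.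
Qed.

HB.instance Definition _ := GRing.Zmodule_isComNzRing.Build loc_ring
  loc_mulA loc_mulC loc_mul1 loc_mulDl loc_one_neq0.

End LocRing.

Section LocLmod.
Variables (A : comNzRingType) (W : mulset A) (M : lmodType A).
Local Notation LM := (loc_mod W M).
Local Notation act := (@loc_act A W M : loc_ring W -> LM -> LM).

Fact loc_actA a b x : act a (act b x) = act (a * b) x.
Proof.
have [c [s ->]] := rfracW a; have [d [t ->]] := rfracW b.
have [m [r ->]] := fracW x.
have -> : rfrac c s * rfrac d t = rfrac (c * d) (denomM s t).
  exact: loc_mulE.
rewrite (loc_actE d m t r) (loc_actE c (d *: m)) (loc_actE (c * d) m).
apply: frac_cancel.
by rewrite !val_denomM !scalerA; congr (_ *: _); ring.
Qed.

Fact loc_act1 : left_id 1 act.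
Proof.
move=> x; have [m [r ->]] := fracW x.
rewrite [LHS]loc_actE; apply: frac_cancel.
by rewrite val_denomM val_denom1 mul1r scale1r.
Qed.

Fact loc_actDr : right_distributive act +%R.
Proof.
move=> a x y; have [c [s ->]] := rfracW a; have [m [r ->]] := fracW x.
have [n [t ->]] := fracW y; rewrite [X in act _ X]fracD.
rewrite (loc_actE c _ s) (loc_actE c m) (loc_actE c n) fracD.
apply: frac_cancel; rewrite !val_denomM !scalerDr !scalerA.
by congr (_ *: _ + _ *: _); ring.
Qed.

Fact loc_actDl x : {morph act^~ x : a b / a + b}.
Proof.
move=> a b; have [c [s ->]] := rfracW a; have [d [t ->]] := rfracW b.
have [m [r ->]] := fracW x; rewrite rfracD.
rewrite (loc_actE _ m) (loc_actE c m) (loc_actE d m) fracD.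
apply: frac_cancel; rewrite !val_denomM !scalerA -!scalerDl !scalerA.
by congr (_ *: _); ring.
Qed.

HB.instance Definition _ := GRing.Zmodule_isLmodule.Build (loc_ring W) LM
  loc_actA loc_act1 loc_actDr loc_actDl.

End LocLmod.

Definition loc_map (A : comNzRingType) (W : mulset A) (M N : lmodType A)
    (g : M -> N) (x : loc_mod W M) : loc_mod W N :=
  frac (g (loc_num x)) (loc_den x).

Lemma loc_mapE (A : comNzRingType) (W : mulset A) (M N : lmodType A)
    (g : {linear M -> N}) (m : M) (s : denom W) :
  loc_map g (frac m s) = frac (g m) s.
Proof.
apply/fracP; have [u Wu e] := loc_numP m s; exists u => //.
have gZ a x : g (a *: x) = a *: g x by exact: linearZZ.
by have := congr1 g e; rewrite !gZ.
Qed.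

Section Mulsets.
Variable A : comNzRingType.

Fact prime_compl1 (P : prime_idealr A) : (1 : A) \notin P.
Proof. by rewrite idealr1. Qed.

Fact prime_complM (P : prime_idealr A) (s t : A) :
  s \notin P -> t \notin P -> s * t \notin P.
Proof. by move=> sP tP; rewrite prime_idealrM negb_or sP. Qed.

Fact prime_compl0 (P : prime_idealr A) : ~ (0 : A) \notin P.
Proof. by rewrite idealr0. Qed.

Definition prime_compl (P : prime_idealr A) : mulset A :=
  @MulSet A [set a | a \notin P] (prime_compl1 P) (@prime_complM P)
    (@prime_compl0 P).

Definition nonzerodiv : set A := [set a | forall b : A, a * b = 0 -> b = 0].

Fact nonzerodiv1 : nonzerodiv 1.
Proof. by move=> b; rewrite mul1r. Qed.

Fact nonzerodivM s t : nonzerodiv s -> nonzerodiv t -> nonzerodiv (s * t).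
Proof. by move=> hs ht b; rewrite -mulrA => /hs /ht. Qed.

Fact nonzerodiv0 : ~ nonzerodiv 0.
Proof. by move=> /(_ 1); rewrite mul0r => /(_ erefl) /eqP; rewrite oner_eq0. Qed.

(* Its localization is the total ring of fractions. *)
Definition regular_elts : mulset A :=
  MulSet nonzerodiv1 nonzerodivM nonzerodiv0.

End Mulsets.

Definition loc_at (A : comNzRingType) (P : prime_idealr A) : comNzRingType :=
  loc_ring (prime_compl P).

Definition loc_mod_at (A : comNzRingType) (P : prime_idealr A)
    (M : lmodType A) : lmodType (loc_at P) :=
  loc_mod (prime_compl P) M.

(** * Dimension and depth of local rings *)

(* The maximal ideal, when A is local. *)
Definition nonunits (A : comNzRingType) : set A :=
  [set a | ~ exists b, a * b = 1].

Definition dim_ge (A : comNzRingType) (n : nat) : Prop :=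
  exists c : nat -> prime_idealr A, forall i, (i < n)%N ->
    {subset c i <= c i.+1} /\ ~ {subset c i.+1 <= c i}.

Definition regular_seq (A : comNzRingType) (s : seq A^o) : Prop :=
  (forall i (x : A), (i < size s)%N ->
     span (take i s) ((s`_i : A) * x : A^o) -> span (take i s) (x : A^o)) /\
  ~ span s (1 : A^o).

Definition depth_ge (A : comNzRingType) (n : nat) : Prop :=
  exists s : seq A^o,
    [/\ size s = n, forall x : A, x \in s -> nonunits x & regular_seq s].

(* depth = dim at every prime, both being suprema. *)
Definition cohen_macaulay (A : comNzRingType) : Prop :=
  forall (P : prime_idealr A) n, depth_ge (loc_at P) n <-> dim_ge (loc_at P) n.

(* depth >= min(k, dim) at every prime. *)
Definition serre_S (k : nat) (A : comNzRingType) : Prop :=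
  forall (P : prime_idealr A) n, (n <= k)%N ->
    dim_ge (loc_at P) n -> depth_ge (loc_at P) n.

(** * Injective resolutions, Gorenstein rings, canonical modules *)

Definition injective_module (A : comNzRingType) (E : lmodType A) : Prop :=
  forall (M N : lmodType A) (i : {linear M -> N}) (g : {linear M -> E}),
    injective i -> exists h : {linear N -> E}, forall x, h (i x) = g x.

Record inj_resolution (A : comNzRingType) (M : lmodType A) := InjResolution {
  res_obj : nat -> lmodType A;
  res_d : forall n, {linear res_obj n -> res_obj n.+1};
  res_aug : {linear M -> res_obj 0};
  res_inj : forall n, injective_module (res_obj n);
  res_aug_inj : injective res_aug;
  res_exact0 : forall x, res_d 0 x = 0 <-> exists m, x = res_aug m;
  res_exact : forall n x, res_d n.+1 x = 0 <-> exists y, x = res_d n y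
}.

Definition finite_injdim (A : comNzRingType) (M : lmodType A) : Prop :=
  exists (I : inj_resolution M) (n : nat),
    forall i (x : res_obj I i), (n < i)%N -> x = 0.

(* [Ext^(i+1)(N, M) = 0], computed with injective resolutions of M. *)
Definition ExtS_vanishes (A : comNzRingType) (i : nat) (N M : lmodType A) :
    Prop :=
  forall (I : inj_resolution M) (g : {linear N -> res_obj I i.+1}),
    (forall x, res_d I i.+1 (g x) = 0) ->
    exists h : {linear N -> res_obj I i}, forall x, g x = res_d I i (h x).

(* For noetherian local rings. *)
Definition gorenstein_local (A : comNzRingType) : Prop := finite_injdim A^o.

(* The codimension of the point P is the dimension of its local ring. *)
Definition gorenstein_codim1 (A : comNzRingType) : Prop :=
  forall P : prime_idealr A, ~ dim_ge (loc_at P) 2 -> gorenstein_local (loc_at P).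

(* A module which, as a complex concentrated in one degree, is a dualizing
   complex: finitely generated, of finite injective dimension, and with
   [A -> RHom(W, W)] an isomorphism.  Over a Cohen-Macaulay ring of finite
   dimension, for instance an F-finite one, these are the canonical modules. *)
Definition canonical_module (A : comNzRingType) (W : lmodType A) : Prop :=
  [/\ fin_gen W,
      finite_injdim W,
      forall a : A, (forall x : W, a *: x = 0) -> a = 0,
      forall g : {linear W -> W}, exists a : A, forall x, g x = a *: x &
      forall i, ExtS_vanishes i W W].

(** * Morphisms of spectra *)

Definition finite_morphism (A B : comNzRingType) (f : {rmorphism A -> B}) :
    Prop :=
  fin_gen (pushforward f B^o).

(* The image of [Spec B -> Spec A] is dense: it meets every nonempty basic open
   set D(a). *)
Definition dominant (A B : comNzRingType) (f : {rmorphism A -> B}) : Prop :=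
  forall a : A, (exists P : prime_idealr A, a \notin P) ->
    exists Q : prime_idealr B, f a \notin Q.

(* The B-linear map [B -> Hom_A(B, A)], [1 |-> T], is an isomorphism after
   tensoring over A with the total ring of fractions of A. *)
Definition generic_iso (A B : comNzRingType) (f : {rmorphism A -> B})
    (T : shriek f A^o) : Prop :=
  bijective (@loc_map A (regular_elts A)
    (pushforward f B^o) (pushforward f (shriek f A^o)) (fun b : B => b *: T)).

Definition F_finite (p : nat) (A : comNzRingType) (chA : p \in [pchar A]) :
    Prop :=
  finite_morphism (pFrobenius_aut chA).

(* Property (!): [F^! W] is isomorphic to W. *)
Definition bang (p : nat) (A : comNzRingType) (chA : p \in [pchar A])
    (W : lmodType A) : Prop :=
  exists theta : {linear W -> shriek (pFrobenius_aut chA) W}, bijective theta.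

(** * Cartier modules and test modules *)

Definition submodule (A : comNzRingType) (M : lmodType A) (N : set M) : Prop :=
  [/\ N 0, forall x y, N x -> N y -> N (x + y) & forall a x, N x -> N (a *: x)].

(* [Hom_A(F^e_* M, M)] *)
Definition cartier_map (p e : nat) (A : comNzRingType) (M : lmodType A) :
    set (M -> M) :=
  [set phi : M -> M | {morph phi : x y / x + y} /\
             forall a x, phi (a ^+ (p ^ e) *: x) = a *: phi x].

(* Extension of a p^-e-linear map to a localization. *)
Definition loc_cartier (p e : nat) (A : comNzRingType) (W : mulset A)
    (M : lmodType A) (phi : M -> M) (x : loc_mod W M) : loc_mod W M :=
  frac (phi (dval (loc_den x) ^+ (p ^ e).-1 *: loc_num x)) (loc_den x).

Lemma loc_cartierE (p e : nat) (A : comNzRingType) (W : mulset A)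
    (M : lmodType A) (phi : M -> M) (m : M) (s : denom W) :
  (0 < p)%N -> cartier_map p e phi ->
  loc_cartier p e phi (frac m s) = frac (phi (dval s ^+ (p ^ e).-1 *: m)) s.
Proof.
move=> p_gt0 [_ phiZ]; rewrite /loc_cartier; apply/fracP.
have [u Wu] := loc_numP m s.
move: (loc_num _) (loc_den _) => m' s' e'; exists u => //.
have : (0 < p ^ e)%N by rewrite expn_gt0 p_gt0.
case: (p ^ e)%N phiZ => // k phiZ _; rewrite -!phiZ succnK; congr phi.
transitivity ((u ^+ k * dval s ^+ k * dval s' ^+ k) *: (u *: (dval s *: m'))).
  by rewrite !scalerA; congr (_ *: _); rewrite !exprS; ring.
by rewrite e' !scalerA; congr (_ *: _); rewrite !exprS; ring.
Qed.

Section TestModule.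
Variables (p : nat) (A : comNzRingType) (M : lmodType A).

(* A Cartier algebra acting on M is given by its homogeneous operators: [C e],
   for e > 0, is the set of operators of the elements of degree e, while degree
   0 acts through A.  Only the action on M enters the notions below. *)
Variable C : nat -> set (M -> M).

Definition cartier_submodule (N : set M) : Prop :=
  submodule N /\
  forall e phi x, (0 < e)%N -> C e phi -> N x -> N (phi x).

Definition associated (eta : prime_idealr A) : Prop :=
  exists m : M, forall a : A, a \in eta <-> a *: m = 0.

(* [H^0_eta (M_eta)]: an ideal power kills x iff all products of n elements of
   the ideal do. *)
Definition H0 (eta : prime_idealr A) : set (loc_mod_at eta M) :=
  [set x | exists n, forall a : 'I_n -> loc_at eta,
     (forall i, nonunits (a i)) -> (\prod_i a i) *: x = 0].

(* [N_eta] as a submodule of [M_eta]; localization is exact. *)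
Definition loc_sub (eta : prime_idealr A) (N : set M) :
    set (loc_mod_at eta M) :=
  [set x | exists m s, N m /\ x = frac m s].

(* The elements phi(x) with phi homogeneous in [C_+] and x in X. *)
Definition Cplus_mul (eta : prime_idealr A) (X : set (loc_mod_at eta M)) :
    set (loc_mod_at eta M) :=
  [set y | exists e phi x, [/\ (0 < e)%N, C e phi, X x &
                               y = loc_cartier p e phi x]].

(* The inclusion of Cartier submodules X `<=` Y is a nil-isomorphism: its kernel
   is zero and a power of [C_+] kills its cokernel.  Products of homogeneous
   elements span that power. *)
Definition nil_iso (eta : prime_idealr A) (X Y : set (loc_mod_at eta M)) :
    Prop :=
  X `<=` Y /\ exists n, iter n (@Cplus_mul eta) Y `<=` X.

(* The torsion submodule of [N_eta] is [loc_sub N `&` H0]. *)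
Definition test_condition (N : set M) : Prop :=
  cartier_submodule N /\
  forall eta, associated eta -> nil_iso (@loc_sub eta N `&` @H0 eta) (@H0 eta).

(* N is the test module [tau(M, C)]. *)
Definition is_test_module (N : set M) : Prop :=
  test_condition N /\ forall N', test_condition N' -> N `<=` N'.

End TestModule.

(* N is [tau(W, kappa)]: the test module for the full Cartier algebra of W, whose
   part of degree e > 0 is [Hom_A(F^e_* W, W)].  The algebra depends on W only;
   a Cartier operator kappa, evaluation at 1 after an isomorphism
   [W -> F^! W], is a generator of it. *)
Definition is_tau (p : nat) (A : comNzRingType) (W : lmodType A) (N : set W) :
    Prop :=
  is_test_module p (fun e => @cartier_map p e A W) N.

Definition F_rational (p : nat) (A : comNzRingType) (W : lmodType A) : Prop :=
  is_tau p [set: W].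

(* Main.v *)
Require Import Defs.
From HB Require Import structures.
From mathcomp Require Import all_boot all_order all_algebra ring_quotient.
From mathcomp Require Import boolp classical_sets ring.

Set Implicit Arguments.
Unset Strict Implicit.
Unset Printing Implicit Defensive.

Import GRing.Theory.
Local Open Scope classical_set_scope.
Local Open Scope ring_scope.

(* By Cohen-Macaulayness the associated primes eta of omega are minimal, so that
   omega_eta has finite length.  Property (!) and End(omega) = A make the socle of
   omega_eta a line, and the images of high Cartier operators on omega_eta lie in
   this socle while never vanishing.  Hence a Cartier submodule N of omega
   satisfies the test condition iff every associated prime of omega is the
   annihilator of an element of N.
   In this form the condition passes from N in omega_S to Tr(N), because a prime
   q = ann(g) contracts to the annihilator of a value g(s) = Tr(s g), and from N
   in omega_R to f^! N = {g | g(S) in N}, because S / q has a nonzero functional to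
   the line A y in N with ann(y) the contraction of q.  So Tr(tau(omega_S)) passes
   the test, and tau(omega_S) is contained in f^! N for each N that does. *)

(** * Linear maps and ideals *)

Lemma linear_ext (A : comNzRingType) (M N : lmodType A) (g : M -> N) :
  linear g -> exists h : {linear M -> N}, forall x, h x = g x.
Proof.
move=> lin_g.
pose h : {linear M -> N} :=
  HB.pack g (GRing.isLinear.Build A M N *:%R g lin_g).
by exists h.
Qed.

Section Ideals.
Variable A : comNzRingType.
Implicit Types P I : set A.

Lemma idealr_of_set I :
  submodule (I : set A^o) -> ~ I 1 -> exists J : idealr A, forall x, x \in J <-> I x.
Proof.
move=> [I0 ID IM] I1; pose J (x : A) := `[< I x >].
have cl : idealr_closed J.
  split=> [||a u v /asboolP Iu /asboolP Iv]; first exact/asboolP.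
    exact/asboolPn.
  by apply/asboolP/ID => //; apply: IM.
pose K : idealr A := HB.pack J (isIdealr.Build A J cl).
by exists K => x; split => /asboolP.
Qed.

Lemma prime_idealr_of_set P :
    submodule (P : set A^o) -> ~ P 1 -> (forall x y, P (x * y) -> P x \/ P y) ->
  exists Q : prime_idealr A, forall x, x \in Q <-> P x.
Proof.
move=> [P0 PD PM] P1 Pprime; pose J (x : A) := `[< P x >].
have cl : idealr_closed J.
  split=> [||a u v /asboolP Pu /asboolP Pv]; first exact/asboolP.
    exact/asboolPn.
  by apply/asboolP/PD => //; apply: PM.
have pr : prime_idealr_closed J.
  by move=> u v /asboolP /Pprime[] h; apply/orP; [left|right]; apply/asboolP.
pose K : prime_idealr A :=
  HB.pack J (isIdealr.Build A J cl) (isPrimeIdealrClosed.Build A J pr).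
by exists K => x; split => /asboolP.
Qed.

End Ideals.

(** * Submodules and generators *)

Section Submodules.
Variables (A : comNzRingType) (M : lmodType A).
Implicit Types (K : set M) (s : seq M) (F : set (set M)).

Lemma submoduleB K x y : submodule K -> K x -> K y -> K (x - y).
Proof. by move=> [_ KD KZ] Kx Ky; rewrite -scaleN1r; apply: KD => //; apply: KZ. Qed.

Lemma submodule_sum K (I : Type) (r : seq I) (c : I -> M) :
  submodule K -> (forall i, K (c i)) -> K (\sum_(i <- r) c i).
Proof. by move=> [K0 KD _] Kc; elim/big_ind: _. Qed.

Lemma span_sub K s m : submodule K -> (forall g, g \in s -> K g) -> Defs.span s m -> K m.
Proof.
move=> sK Ks [c ->]; apply: submodule_sum => // i.
by case: sK => _ _; apply; apply/Ks/mem_nth.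
Qed.

Lemma span_mem s g : g \in s -> Defs.span s g.
Proof.
move=> gs; exists (fun i => (i == index g s)%:R).
have lt_g : (index g s < size s)%N by rewrite index_mem.
rewrite (bigD1 (Ordinal lt_g)) //= eqxx scale1r nth_index // big1 ?addr0 // => i.
by rewrite -val_eqE /= => /negPf ->; rewrite scale0r.
Qed.

(** Generation as an induction principle, without coefficients: a property closed under the module
    operations need only be checked on [s]. *)
Definition generates s := forall K, submodule K ->
  (forall g, g \in s -> K g) -> forall m, K m.

Lemma fin_gen_generates : fin_gen M -> exists s, generates s.
Proof. by move=> [s gs]; exists s => K sK Ks m; apply: span_sub (gs m). Qed.

(** Each element of the finite [s] enters the chain at some member, and the largest of these members
    contains them all. The fixed set [K] gives Zorn's lemma a starting point: the union of the empty
    chain is empty, but together with [K] it is [K]. *)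
Lemma total_bigcup_seq K F s :
    total_on F subset ->
    (forall g, g \in s -> (K `|` \bigcup_(X in F) X) g) ->
  (forall g, g \in s -> K g) \/
  exists2 X, F X & forall g, g \in s -> (K `|` X) g.
Proof.
move=> totF; elim: s => [|g s IH] hs; first by left.
have [Ks|[X FX Xs]] : (forall g, g \in s -> K g) \/
    exists2 X, F X & forall g, g \in s -> (K `|` X) g.
- by apply: IH => x xs; apply: hs; rewrite inE xs orbT.
- have [Kg|[X FX Xg]] := hs g (mem_head _ _).
    by left=> x; rewrite inE => /predU1P[->|/Ks].
  by right; exists X => // x; rewrite inE => /predU1P[->|/Ks]; [right|left].
have [Kg|[Y FY Yg]] := hs g (mem_head _ _).
  by right; exists X => // x; rewrite inE => /predU1P[->|/Xs //]; left.
have [XY|YX] := totF _ _ FX FY.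
  right; exists Y => // x; rewrite inE => /predU1P[->|/Xs[]]; [by right|by left|].
  by move/XY; right.
right; exists X => // x; rewrite inE => /predU1P[->|/Xs //].
by right; apply: YX.
Qed.

Lemma total_bigcup_submodule K F : submodule K ->
    total_on F subset -> (forall X, F X -> submodule (K `|` X)) ->
  submodule (K `|` \bigcup_(X in F) X).
Proof.
move=> sK totF sF.
have sub X : F X -> K `|` X `<=` K `|` \bigcup_(X in F) X.
  by move=> FX x [Kx|Xx]; [left | right; exists X].
split=> [|x y Ux Uy|a x Ux]; first by left; case: sK.
  have [|Ks|[X FX Xs]] := @total_bigcup_seq K F [:: x; y] totF.
  - by move=> g; rewrite !inE => /orP[] /eqP ->.
  - by left; case: sK => _ KD _; apply: KD; apply: Ks; rewrite !inE eqxx ?orbT.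
  - by apply: (sub X) => //; case: (sF X FX) => _ XD _; apply: XD; apply: Xs;
       rewrite !inE eqxx ?orbT.
case: Ux => [Kx|[X FX Xx]]; first by left; case: sK => _ _; apply.
by apply: (sub X) => //; case: (sF X FX) => _ _; apply; right.
Qed.

End Submodules.

Lemma generates_pushforward (A B : comNzRingType) (f : {rmorphism A -> B})
    (M : lmodType B) (r : seq (pushforward f B^o)) (s : seq M) :
    generates r -> generates s ->
  @generates A (pushforward f M) [seq (b : B) *: m | b <- r, m <- s].
Proof.
move=> gr gs K sK Ks m; have [K0 KD KZ] := sK.
suff : forall b : B, K (b *: m) by move/(_ 1); rewrite scale1r.
apply: (gs [set m : M | forall b : B, K (b *: m)]) => {m} [|m ms].
  split=> [b|x y Kx Ky b|a x Kx b]; first by rewrite scaler0.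
    by rewrite scalerDr; apply: KD.
  by rewrite scalerA.
apply: (gr [set b | K ((b : B) *: m)]) => [|b br].
  split=> [|x y Kx Ky|a x Kx] /=; first by rewrite scale0r.
    by rewrite scalerDl; apply: KD.
  have -> : ((a *: x : pushforward f B^o) : B) *: m =
      a *: ((x : B) *: m : pushforward f M).
    by rewrite -[LHS]scalerA.
  exact: KZ.
by apply: Ks; apply/allpairsP; exists (b, m).
Qed.

(** * Prime annihilators over a noetherian ring *)

Section MaximalAnnihilator.
Variables (A : comNzRingType) (M : lmodType A).

Lemma submodule_ann (x : M) : submodule ([set a : A | a *: x = 0] : set A^o).
Proof.
split=> [|a b /= ax bx|a b /= bx]; first by rewrite /= scale0r.
  by rewrite scalerDl ax bx addr0.
by rewrite -[a *: b]/(a * b : A) -scalerA bx scaler0.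
Qed.

(** A maximal annihilator among those of nonzero multiples of [x] is prime. It exists because the
    union of a chain of annihilators is a finitely generated ideal, hence is attained in the
    chain. *)
Lemma exists_prime_ann (x : M) : noetherian A -> x != 0 ->
  exists (q : prime_idealr A) (t : A), forall a, a \in q <-> a *: (t *: x) = 0.
Proof.
move=> noeth x0; pose ann t : set A := [set a | a *: (t *: x) = 0].
pose K : set A := [set a | a *: x = 0].
have Kx : ann 1 = K by apply/seteqP; split=> a; rewrite /ann /K /= scale1r.
have [F subF totF|X [[t t0 Xt] maxX]] := @Zorn_bigcup A
    [set X : set A | exists2 t, t *: x != 0 & K `|` X = ann t].
  have sK : submodule (K : set A^o) by apply: submodule_ann.
  have sI : submodule (K `|` \bigcup_(X in F) X : set A^o).
    apply: (total_bigcup_submodule sK totF) => Y /subF[u _ ->].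
    exact: (submodule_ann (u *: x)).
  have [|J JP] := idealr_of_set sI.
    move=> [/eqP|[Y /subF[u u0 Yu] Y1]]; first by rewrite scale1r; apply/negP.
    have : ann u 1 by rewrite -Yu; right.
    by rewrite /ann /= scale1r; apply/eqP.
  have [s sP] := noeth J.
  have sJ g : g \in s -> (K `|` \bigcup_(X in F) X) g.
    by move=> gs; apply/JP/sP/(@span_mem A A^o).
  have [Ks|[Y FY Ys]] := @total_bigcup_seq A A^o K F s totF sJ.
    exists 1; first by rewrite scale1r.
    rewrite Kx; apply/seteqP; split=> [a|a]; last by left.
    by move/JP/sP; apply: (@span_sub A A^o).
  have [u u0 Yu] := subF _ FY; exists u => //; rewrite -Yu.
  apply/seteqP; split=> a; last by case; [left | right; exists Y].
  move/JP/sP; apply: (@span_sub A A^o) => //.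
  by rewrite Yu; exact: (submodule_ann (u *: x)).
have [|||q qP] := @prime_idealr_of_set A (ann t).
- exact: (submodule_ann (t *: x)).
- by rewrite /ann /= scale1r; apply/eqP.
- move=> a b; rewrite /ann /= => abt.
  have [/eqP bt|bt] := boolP (b *: (t *: x) == 0); [by right | left].
  (* If [b] does not kill [t *: x], the annihilator of [(b * t) *: x] contains that of [t *: x] and
     also [a]; maximality forces [a] to kill [t *: x]. *)
  apply: contrapT => at0; apply: (maxX (ann (b * t))).
    split=> [c Xc|/(_ a)] /=; rewrite /ann /=.
      have : ann t c by rewrite -Xt; right.
      by rewrite /ann /= => tc; rewrite scalerA mulrCA -!scalerA tc scaler0.
    rewrite -scalerA scalerA abt => /(_ erefl) Xa.
    by have : ann t a by rewrite -Xt; right.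
  exists (b * t); first by rewrite -scalerA.
  apply/seteqP; split=> [c [Kc|//]|]; last by right.
  rewrite /ann /= scalerA mulrC -scalerA; have -> : c *: x = 0 by [].
  by rewrite scaler0.
by exists q, t.
Qed.

End MaximalAnnihilator.

(** * Functionals at a prime *)

Section LocalFunctionals.
Variables (A : comNzRingType) (eta : prime_idealr A).

Lemma not_primeM s t : s \notin eta -> t \notin eta -> s * t \notin eta.
Proof. by move=> sP tP; rewrite prime_idealrM negb_or sP. Qed.

Section Saturated.
Variable M : lmodType A.
Implicit Types (K : set M) (s : seq M).

(* Kernels of [M -> (M / K)_eta]. *)
Definition saturated K :=
  submodule K /\ forall t w, t \notin eta -> K (t *: w) -> K w.

Definition saturation K : set M := [set w | exists2 t, t \notin eta & K (t *: w)].

Lemma saturation_sub K : K `<=` saturation K.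
Proof. by move=> w Kw; exists 1; rewrite ?idealr1 ?scale1r. Qed.

Lemma saturatedP K : submodule K -> saturated (saturation K).
Proof.
move=> sK; have [K0 KD KZ] := sK.
split; first split=> [|x y [t tP Kx] [u uP Ky]|a x [t tP Kx]].
- exact: saturation_sub.
- exists (t * u); first exact: not_primeM.
  rewrite scalerDr; apply: KD; last by rewrite -scalerA; apply: KZ.
  by rewrite mulrC -scalerA; apply: KZ.
- by exists t => //; rewrite scalerA mulrC -scalerA; apply: KZ.
move=> t w tP [u uP]; rewrite scalerA => Kw; exists (u * t) => //.
exact: not_primeM.
Qed.

Lemma submodule_adjoin K w :
  submodule K -> submodule [set x | exists k c, K k /\ x = k + c *: w].
Proof.
move=> [K0 KD KZ]; split=> [|_ _ [k [c [Kk ->]]] [l [d [Kl ->]]]|a _ [k [c [Kk ->]]]].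
- by exists 0, 0; split=> //; rewrite scale0r addr0.
- by exists (k + l), (c + d); split; [exact: KD | rewrite scalerDl addrACA].
- by exists (a *: k), (a * c); split; [exact: KZ | rewrite scalerDr scalerA].
Qed.

(** Zorn's lemma applies because a finite [s] cannot be swallowed by a chain before a single member
    swallows it. For [w] outside the maximal [L], the saturation of [L + A w] must contain [s]. So
    every nonzero submodule of [(M / L)_eta] contains the image of [s]. *)
Lemma exists_maximal_saturated K s :
    saturated K -> ~ (forall g, g \in s -> K g) ->
  exists L, [/\ saturated L, K `<=` L, ~ (forall g, g \in s -> L g) &
    forall w, ~ L w -> forall g, g \in s ->
      exists t c, t \notin eta /\ L (t *: g - c *: w)].
Proof.
move=> [sK satK] Ks.
have [F subF totF|X [[satX Xs] maxX]] := @Zorn_bigcup M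
    [set X | saturated (K `|` X) /\ ~ (forall g, g \in s -> (K `|` X) g)].
  split; last first.
    by move=> Us; have [//|[X /subF[]]] := total_bigcup_seq totF Us.
  split; first by apply: total_bigcup_submodule => // X /subF[[]].
  move=> t w tP [Kw|[X FX Xw]]; first by left; apply: satK Kw.
  have [[_ satX] _] := subF _ FX.
  have [|Kw|Xw'] := satX t w tP; [by right | by left | by right; exists X].
exists (K `|` X); split=> // w Xw g gs.
pose Y := saturation [set x | exists k c, (K `|` X) k /\ x = k + c *: w].
have [sX _] := satX.
have XY : K `|` X `<=` Y.
  move=> x Xx; apply: saturation_sub; exists x, 0; split=> //.
  by rewrite scale0r addr0.
have KY : K `|` Y = Y.
  by apply/seteqP; split=> x; [case=> // Kx; apply: XY; left | right].
have : ~ ~ (forall g, g \in s -> Y g).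
  move=> Ys; apply: (maxX Y).
    split=> [x Xx|/(_ w) YX]; first by apply: XY; right.
    apply: Xw; right; apply: YX; apply: saturation_sub; exists 0, 1.
    by split; [case: sX | rewrite add0r scale1r].
  by split; rewrite KY //; apply/saturatedP/submodule_adjoin.
move/contrapT=> /(_ g gs)[t tP [k [c [Xk e]]]]; exists t, c; split=> //.
by rewrite e addrK.
Qed.

End Saturated.

Section Functional.
Variables (M W : lmodType A) (s : seq M).
Hypothesis gen_s : generates s.
Variable x : W.
Hypothesis eta_x : forall a, a \in eta -> a *: x = 0.

(* At [eta] the quotient [M / L] is a line generated by [m0]. *)
Lemma line_functional (L : set M) (m0 : M) :
    saturated L -> ~ L m0 -> (forall a m, a \in eta -> L (a *: m)) ->
    (forall m, ~ L m -> exists t c, t \notin eta /\ L (t *: m0 - c *: m)) ->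
  exists h : {linear M -> W}, [/\ forall m, L m -> h m = 0,
    forall m, exists c, h m = c *: x &
    exists2 c, c \notin eta & h m0 = c *: x].
Proof.
move=> [sL satL] Lm0 etaL line; have [L0 LD LZ] := sL.
have coef m : exists t c, t \notin eta /\ L (t *: m - c *: m0).
  have [Lm|/line[t [c [tP Lc]]]] := pselect (L m).
    by exists 1, 0; rewrite idealr1 scale1r scale0r subr0.
  (* The two coefficients of [line] trade places: if [c] were in [eta], then [c *: m], hence
     [t *: m0], hence [m0] would lie in [L]. *)
  exists c, t; split; last by rewrite -opprB -scaleN1r; apply: LZ.
  apply/negP => cP; apply/Lm0/(satL t) => //.
  by rewrite -(subrK (c *: m) (t *: m0)); apply: LD => //; apply: etaL.
(* A common denominator [t] for the finitely many generators puts [t *: M] inside [L + A m0]. *)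
have [t tP tL] : exists2 t, t \notin eta &
    forall m, exists c, L (t *: m - c *: m0).
  have [t tP ts] : exists2 t, t \notin eta &
      forall g, g \in s -> exists c, L (t *: g - c *: m0).
    elim: (s) => [|g r [t tP tr]]; first by exists 1; rewrite ?idealr1.
    have [u [c [uP Lc]]] := coef g; exists (u * t); first exact: not_primeM.
    move=> k; rewrite inE => /predU1P[->|/tr[d Ld]].
      exists (t * c); rewrite mulrC -!scalerA -scalerBr; exact: LZ.
    exists (u * d); rewrite -!scalerA -scalerBr; exact: LZ.
  exists t => //; apply: (gen_s (K := [set m | exists c, L (t *: m - c *: m0)])) => //.
  split=> [|m n [c Lc] [d Ld]|a m [c Lc]].
  - by exists 0; rewrite scaler0 scale0r subr0.
  - by exists (c + d); rewrite scalerDr scalerDl opprD addrACA; apply: LD.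
  - exists (a * c); rewrite scalerA mulrC -!scalerA -scalerBr; exact: LZ.
have [c cL] := choice tL.
(* As [m0] is outside the saturated [L], the coefficient [c m] is determined modulo [eta], which
   kills [x]. So [m |-> c m *: x] is well defined and linear. *)
have cE m d : L (t *: m - d *: m0) -> c m *: x = d *: x.
  move=> Ld; apply/eqP; rewrite -subr_eq0 -scalerBl; apply/eqP/eta_x.
  apply: contrapT => /negP cd; apply/Lm0/(satL _ _ cd).
  rewrite scalerBl; have -> : c m *: m0 - d *: m0 =
      (t *: m - d *: m0) - (t *: m - c m *: m0).
    by rewrite [RHS]addrC opprB addrA subrK.
  exact: submoduleB.
have [h hE] : exists h : {linear M -> W}, forall m, h m = c m *: x.
  apply: linear_ext => a m n; rewrite scalerA -scalerDl; apply: cE.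
  rewrite scalerDr scalerDl opprD addrACA; apply: LD => //.
  rewrite scalerA mulrC -!scalerA -scalerBr; exact: LZ.
exists h; split=> [m Lm|m|].
- by rewrite hE (cE m 0) ?scale0r ?subr0 //; apply: LZ.
- by exists (c m); rewrite hE.
- by exists t => //; rewrite hE; apply: cE; rewrite subrr.
Qed.

(** Here the element with nonzero value is prescribed, at the price of assuming that [eta] kills
    [M / K]. A saturated [L] maximal without [m0] leaves a quotient killed by [eta] in which, at
    [eta], each nonzero element generates [m0]. *)
Lemma exists_functional_at (K : set M) (m0 : M) :
    saturated K -> (forall a m, a \in eta -> K (a *: m)) -> ~ K m0 ->
  exists h : {linear M -> W}, [/\ forall m, K m -> h m = 0,
    forall m, exists c, h m = c *: x &
    exists2 c, c \notin eta & h m0 = c *: x].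
Proof.
move=> satK etaK Km0.
have [|L [satL KL Lm0 maxL]] := @exists_maximal_saturated M K [:: m0] satK.
  by move/(_ m0 (mem_head _ _)).
have [||m /maxL/(_ _ (mem_head _ _))//|h [hL hx hm0]] :=
    @line_functional L m0 satL.
- by move=> Lm0'; apply: Lm0 => g; rewrite inE => /eqP ->.
- by move=> a m /(etaK a m)/KL.
- by exists h; split=> // m /KL/hL.
Qed.

(* Nakayama's lemma: maximality of [L] makes [(M / L)_eta] simple, hence killed
   by [eta]. *)
Lemma exists_functional (K : set M) : saturated K -> ~ (forall m, K m) ->
  exists (h : {linear M -> W}) (m0 : M), [/\ forall m, K m -> h m = 0,
    forall m, exists c, h m = c *: x &
    exists2 c, c \notin eta & h m0 = c *: x].
Proof.
move=> satK Kproper.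
have [|L [[sL satL] KL Ls maxL]] := @exists_maximal_saturated M K s satK.
  by move=> Ks; apply: Kproper; apply: gen_s Ks; case: satK.
have [L0 LD LZ] := sL.
have etaL a m : a \in eta -> L (a *: m).
  move=> aP; apply: (gen_s (K := [set m | L (a *: m)])) => [|g gs].
    split=> [|y z Ly Lz|b y Ly] /=; first by rewrite scaler0.
      by rewrite scalerDr; apply: LD.
    by rewrite scalerA mulrC -scalerA; apply: LZ.
  (* If [a *: g] is outside [L], then [(t - c * a) *: g] lies in [L] for some [t] outside [eta]; as
     [t - c * a] is outside [eta] too, [g] lies in [L]. *)
  apply: contrapT => Lag; have [t [c [tP]]] := maxL _ Lag g gs.
  rewrite scalerA -scalerBl => Lg; apply/Lag/LZ/(satL _ _ _ Lg).
  by apply/negP => tcP; move/negP: tP; apply; rewrite -(subrK (c * a) t) rpredD ?idealMr.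
have [m0 m0s Lm0] : exists2 m0, m0 \in s & ~ L m0.
  apply: contrapT => nex; apply: Ls => g gs; apply: contrapT => Lg.
  by apply: nex; exists g.
have [|m /maxL/(_ _ m0s)//|h [hL hx hm0]] := @line_functional L m0 _ Lm0 etaL.
  by split.
by exists h, m0; split=> // m /KL/hL.
Qed.

End Functional.
End LocalFunctionals.

(** * Cohen-Macaulay rings have no embedded primes *)

(** An ideal maximal among those containing no power of [x] is prime. *)
Lemma not_nilpotent_prime (A : comNzRingType) (x : A) :
  (forall n, x ^+ n != 0) -> exists P : prime_idealr A, x \notin P.
Proof.
move=> xn0; pose K : set A := [set 0].
have [F subF totF|X [[sX xX] maxX]] := @Zorn_bigcup A
    [set X | submodule (K `|` X : set A^o) /\ forall n, ~ (K `|` X) (x ^+ n)].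
  split=> [|n [/eqP|[X FX Xx]]]; last 1 first.
  - by have [_ /(_ n)] := subF _ FX; apply; right.
  - apply: (@total_bigcup_submodule A A^o) => // [|X /subF[]//].
    split=> [//|a b -> ->|a b ->]; first by rewrite addr0.
    exact: mulr0.
  - by apply/negP.
have adjoin a : ~ (K `|` X) a -> exists n k c, (K `|` X) k /\ x ^+ n = k + c * a.
  move=> Xa; apply: contrapT => nex.
  pose Y := [set y : A | exists k c, (K `|` X) k /\ y = k + c * a].
  have KY : K `|` Y = Y.
    apply/seteqP; split=> y; last by right.
    by case=> // ->; exists 0, 0; split; [left | rewrite mul0r addr0].
  apply: (maxX Y).
    split=> [y Xy|/(_ a) YX]; first by exists y, 0; split; [right | rewrite mul0r addr0].
    by apply: Xa; right; apply: YX; exists 0, 1; split; [left | rewrite mul1r add0r].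
  split=> [|n]; rewrite KY; last by move=> [k [c [Xk e]]]; apply: nex; exists n, k, c.
  exact: (@submodule_adjoin A A^o (K `|` X) a sX).
have [X0 XD XZ] := sX.
have [|a b Xab|P PX] := prime_idealr_of_set sX.
- by move/(xX 0).
(* If neither [a] nor [b] is in the ideal, adjoining either one captures a power of [x]; the product
   of the two powers lies in the ideal because [a * b] does. *)
- apply: contrapT => /not_orP[/adjoin[m [k [c [Xk em]]]] /adjoin[n [l [d [Xl en]]]]].
  apply: (xX (m + n)%N); rewrite exprD em en.
  have -> : (k + c * a) * (l + d * b) =
      (l + d * b) * k + ((c * a) * l + (c * d) * (a * b)).
    by ring.
  by apply: (XD); [exact: XZ | apply: XD; exact: XZ].
- by exists P; apply/negP => /PX; apply: (xX 1%N).
Qed.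

Lemma expr_pXD (A : comNzRingType) (p : nat) (chA : p \in [pchar A]) e (a b : A) :
  (a + b) ^+ (p ^ e) = a ^+ (p ^ e) + b ^+ (p ^ e).
Proof.
rewrite exprDn_pchar // pnatX (eq_pnat _ (pcharf_eq chA)).
by rewrite pnat_id ?(pcharf_prime chA) ?orbT.
Qed.

Lemma prime_idealrX (A : comNzRingType) (P : prime_idealr A) a n :
  a ^+ n \in P -> a \in P.
Proof.
elim: n => [|n IH]; first by rewrite expr0 idealr1.
by rewrite exprS prime_idealrM => /orP[|/IH].
Qed.

Section LocalAt.
Variables (A : comNzRingType) (eta : prime_idealr A).
Local Notation Aeta := (loc_at eta).
Local Notation rf := (@rfrac A (prime_compl eta) : A -> _ -> Aeta).
Implicit Types (s t : denom (prime_compl eta)).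

Lemma rfracM a b s t : rf a s * rf b t = rf (a * b) (denomM s t).
Proof. exact: loc_mulE. Qed.

Lemma rfrac_eq1 s : rf (dval s) s = 1.
Proof. by apply: rfrac_cancel; rewrite val_denom1 mul1r mulr1. Qed.

Lemma rfrac_unit a s : a \notin eta -> exists b, rf a s * b = 1.
Proof.
move=> aP; exists (rf (dval s) (mk_denom (W := prime_compl eta) aP)).
rewrite rfracM -[RHS](rfrac_eq1 s); apply: rfrac_cancel.
by rewrite val_denomM -[dval (mk_denom _)]/a; ring.
Qed.

Lemma rfrac_eq0 a s : rf a s = 0 <-> exists2 t, t \notin eta & t * a = 0.
Proof.
rewrite /rfrac -[0]/(Defs.frac (0 : A^o) (denom1 (prime_compl eta))).
split=> [/fracP[u uP]|[t tP ta]].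
  by rewrite val_denom1 scale1r !scaler0 => ua; exists u.
apply/fracP; exists t => //; rewrite val_denom1 scale1r !scaler0.
exact: ta.
Qed.

Lemma nonunits_rfrac a s : nonunits (rf a s) <-> a \in eta.
Proof.
split=> [nu|aP [y]]; first by apply: contrapT => /negP /(rfrac_unit s).
have [b [t ->]] := rfracW y; rewrite rfracM -(rfrac_eq1 (denom1 _)).
move=> /(@fracP A (prime_compl eta) A^o)[u uP]; rewrite /= val_denom1 scale1r.
move=> /(congr1 (fun x => x \in eta)).
rewrite -![_ *: _]/(_ * _ : A) !prime_idealrM aP (negPf uP) /=.
have /negPf -> : dval s \notin eta := denomP s.
have /negPf -> : dval t \notin eta := denomP t.
by rewrite idealr1.
Qed.

Lemma maximal_loc : exists P : prime_idealr Aeta,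
  forall a s, rf a s \in P <-> a \in eta.
Proof.
pose I : set Aeta := @nonunits Aeta.
have IE a s : I (rf a s) <-> a \in eta by apply: nonunits_rfrac.
have [||x y|P PI] := @prime_idealr_of_set Aeta I.
- split=> [|x y|x y].
  + by apply/(IE 0 (denom1 _)); rewrite rpred0.
  + have [a [s ->]] := rfracW x; have [b [t ->]] := rfracW y.
    by rewrite rfracD => /IE aP /IE bP; apply/IE; rewrite rpredD ?idealMr.
  + have [a [s ->]] := rfracW x; have [b [t ->]] := rfracW y.
    rewrite -[_ *: _]/(rf a s * rf b t : Aeta) rfracM => /IE bP.
    by apply/IE; rewrite idealMr.
- by apply; exists 1; rewrite mulr1.
- have [a [s ->]] := rfracW x; have [b [t ->]] := rfracW y.
  by rewrite rfracM => /IE; rewrite prime_idealrM => /orP[]; [left|right]; apply/IE.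
- by exists P => a s; rewrite -IE; apply: PI.
Qed.

(** If [a] were not nilpotent in the local ring, a prime avoiding it and the maximal ideal would
    form a strict chain. *)
Lemma dim0_nilpotent : ~ dim_ge Aeta 1 ->
  forall a, a \in eta -> exists (t : A) n, t \notin eta /\ t * a ^+ n = 0.
Proof.
move=> dim0 a aP; apply: contrapT => nex; apply: dim0.
pose x := rf a (denom1 _).
have xn n : x ^+ n = rf (a ^+ n) (denom1 _).
  elim: n => [|n IH]; first by rewrite !expr0.
  rewrite !exprS IH rfracM; apply: rfrac_cancel.
  by rewrite val_denomM val_denom1 mulr1.
have [n|P xP] := @not_nilpotent_prime Aeta x.
  rewrite xn; apply/eqP => /rfrac_eq0[t tP ta].
  by apply: nex; exists t, n.
have [m mP] := maximal_loc.
(* The chain is constant from its second term on; [dim_ge _ 1] inspects only the first inclusion. *)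
exists (fun i => if i is 0%N then P else m) => -[//|//] _; split=> [y|mP'].
  have [b [s ->]] := rfracW y => bP; apply/mP; apply: contrapT.
  move=> /negP /(rfrac_unit s)[c cb].
  by have := idealr1 P; rewrite -cb mulrC idealMr.
by move/negP: xP; apply; apply: mP'; apply/mP.
Qed.

(** The maximal ideal of the localization kills the nonzero element [b / 1], so it contains no
    regular element: the depth is 0, and so is the dimension. *)
Lemma associated_dim0 (b : A) : cohen_macaulay A ->
  (forall a, a \in eta <-> a * b = 0) -> ~ dim_ge Aeta 1.
Proof.
move=> cm etab /cm[[|x [|? ?]] [//= _ nu [reg _]]].
have : nonunits x by apply: nu; rewrite inE.
have [a [s ex]] := rfracW x; rewrite {}ex in nu reg *.
move/nonunits_rfrac/etab => ab0.
have : Defs.span [::] (rf b (denom1 _) : Aeta^o).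
  apply: (reg 0%N) => //=; exists (fun=> 0); rewrite big_ord0 rfracM ab0.
  by apply/rfrac_eq0; exists 1; rewrite ?idealr1 ?mulr0.
case=> c; rewrite big_ord0 => /rfrac_eq0[t tP /etab].
by apply/negP.
Qed.

(** One [t] and one [e] serve the finitely many generators of [eta]. As [p ^ e]-th powers are
    additive, they serve all of [eta]. *)
Lemma frobenius_nilpotent (p : nat) : p \in [pchar A] -> noetherian A ->
    (forall a, a \in eta -> exists (t : A) n, t \notin eta /\ t * a ^+ n = 0) ->
  exists (t : A) e, t \notin eta /\ forall a, a \in eta -> t * a ^+ (p ^ e) = 0.
Proof.
move=> chA noeth nil; have [r rP] := noeth eta.
have p_gt1 := prime_gt1 (pcharf_prime chA).
have r_eta g : g \in r -> g \in eta by move=> gr; apply/rP/(@span_mem A A^o).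
have up (t a : A) m n : (m <= n)%N -> t * a ^+ m = 0 -> t * a ^+ n = 0.
  by move=> /subnKC <- h; rewrite exprD mulrA h mul0r.
have [t [e [tP tr]]] : exists (t : A) e, t \notin eta /\
    forall g : A, g \in r -> t * g ^+ (p ^ e) = 0.
  elim: r r_eta {rP} => [|g r IH] r_eta; first by exists 1, 0%N; rewrite idealr1.
  have [|t [e [tP tr]]] := IH; first by move=> x xr; apply: r_eta; rewrite inE xr orbT.
  have [u [n [uP un]]] := nil g (r_eta _ (mem_head _ _)).
  exists (t * u), (maxn e n); split; first exact: not_primeM.
  move=> x; rewrite inE => /predU1P[->|/tr tx].
    rewrite -mulrA (up u g n) ?mulr0 //.
    apply: leq_trans (ltnW (ltn_expl n p_gt1)) _.
    by rewrite leq_exp2l // leq_maxr.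
  rewrite mulrAC (up t x (p ^ e)%N) ?mul0r //.
  by rewrite leq_exp2l // leq_maxl.
exists t, e; split=> // a /rP.
apply: (@span_sub A A^o [set a | t * a ^+ (p ^ e) = 0]) => //.
split=> [|x y /= tx ty|b x /= tx].
- by rewrite /= expr0n gtn_eqF ?mulr0 // expn_gt0 ltnW.
- by rewrite /= (expr_pXD chA) mulrDr tx ty addr0.
- by rewrite -[b *: x]/(b * x : A) exprMn mulrCA tx mulr0.
Qed.

End LocalAt.

(** * Associated primes of a canonical module *)

Definition is_ann (A : comNzRingType) (M : lmodType A) (eta : prime_idealr A)
  (y : M) : Prop := forall a, a \in eta <-> a *: y = 0.

Section Annihilators.
Variables (A : comNzRingType) (M : lmodType A) (eta : prime_idealr A).

Lemma is_annZ (y : M) (c : A) : is_ann eta y -> c \notin eta -> is_ann eta (c *: y).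
Proof.
move=> ann_y cP a; rewrite scalerA -ann_y prime_idealrM (negPf cP) orbF.
by [].
Qed.

Lemma saturated_torsion : saturated eta (saturation eta [set (0 : M)]).
Proof.
apply: saturatedP.
by split=> [//|x y -> ->|a x ->]; [exact: addr0 | exact: scaler0].
Qed.

(* The prime [eta] is the intersection of the finitely many annihilators of the
   values on generators. *)
Lemma is_ann_value (B : lmodType A) (g : {linear B -> M}) (s : seq B) :
    generates s -> (forall a, a \in eta <-> forall b, a *: g b = 0) ->
  exists b, is_ann eta (g b).
Proof.
move=> gen_s etag; apply: contrapT => nex.
have kill b : exists2 t, t \notin eta & t *: g b = 0.
  apply: contrapT => nt; apply: nex; exists b => a; split=> [/etag//|gb].
  by apply: contrapT => /negP aP; apply: nt; exists a.
have [t tP ts] : exists2 t, t \notin eta & forall b, b \in s -> t *: g b = 0.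
  elim: (s) => [|b r [t tP tr]]; first by exists 1; rewrite ?idealr1.
  have [u uP ub] := kill b; exists (u * t); first exact: not_primeM.
  move=> x; rewrite inE => /predU1P[->|/tr tx].
    by rewrite mulrC -scalerA ub scaler0.
  by rewrite -scalerA tx scaler0.
move/negP: tP; apply; apply/etag; apply: (gen_s [set b | t *: g b = 0]) => //.
split=> [|x y /= tx ty|a x /= tx]; first by rewrite /= raddf0 scaler0.
  by rewrite raddfD scalerDr tx ty addr0.
by rewrite linearZZ scalerA mulrC -scalerA tx scaler0.
Qed.

End Annihilators.

(** A functional from [W] to the line [A x] is an endomorphism of [W], hence multiplication by some
    [b]. Faithfulness turns [eta *: (b *: W) = 0] into [eta * b = 0], and the value outside the
    torsion gives the converse. *)
Lemma associated_ring (A : comNzRingType) (W : lmodType A) (eta : prime_idealr A) :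
    canonical_module W -> associated W eta ->
  exists b : A, forall a, a \in eta <-> a * b = 0.
Proof.
move=> [/fin_gen_generates[s gen_s] _ faithful endo _] [x ann_x].
have eta_x a : a \in eta -> a *: x = 0 by move/ann_x.
have satK := @saturated_torsion A W eta.
have [|h [m0 [_ hx [c cP hm0]]]] := exists_functional gen_s eta_x satK.
  by move/(_ x) => [t tP /ann_x]; apply/negP.
have [b hb] := endo h; exists b => a; split=> [aP|ab].
  apply: faithful => w; rewrite -scalerA -hb; have [d ->] := hx w.
  by rewrite scalerA mulrC -scalerA eta_x ?scaler0.
have /ann_x : (a * c) *: x = 0 by rewrite -scalerA -hm0 hb scalerA ab scale0r.
by rewrite prime_idealrM (negPf cP) orbF.
Qed.

(** * Cartier operators *)

Section FrobeniusPower.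
Variables (p : nat) (A : comNzRingType) (chA : p \in [pchar A]) (e : nat).

(** The proof of the characteristic is an argument so that the ring morphism structure, which
    depends on it, can be inferred from the term. *)
Definition frob_pow of p \in [pchar A] := fun a : A => a ^+ (p ^ e).

Local Notation F := (frob_pow chA).

Fact frob_pow_zmod_morphism : zmod_morphism F.
Proof.
move=> a b; have := expr_pXD chA e (a - b) b; rewrite subrK -/(F a) => ab.
by apply/eqP; rewrite eq_sym subr_eq; apply/eqP; apply: ab.
Qed.

Fact frob_pow_monoid_morphism : monoid_morphism F.
Proof. by split=> [|a b]; rewrite /frob_pow ?expr1n ?exprMn. Qed.

HB.instance Definition _ := GRing.isZmodMorphism.Build A A F frob_pow_zmod_morphism.
HB.instance Definition _ := GRing.isMonoidMorphism.Build A A F frob_pow_monoid_morphism.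

End FrobeniusPower.

Lemma generates_frob_pow (p : nat) (A : comNzRingType) (chA : p \in [pchar A])
    (W : lmodType A) (e : nat) : F_finite chA -> fin_gen W ->
  exists s, @generates A (pushforward (frob_pow e chA) W) s.
Proof.
move=> /fin_gen_generates[r gen_r] /fin_gen_generates[s0 gen_s0].
elim: e => [|e [s gen_s]].
  by exists s0 => K [K0 KD KZ]; apply: gen_s0; split.
have gen := @generates_pushforward A A (pFrobenius_aut chA) _ r s gen_r gen_s.
exists [seq (b : A) *: (m : pushforward (frob_pow e chA) W) | b <- r, m <- s].
move=> K [K0 KD KZ]; apply: gen; split=> // a x Kx.
have := KZ a x Kx; rewrite -[_ *: _]/((a ^+ (p ^ e.+1)) *: (x : W)).
by rewrite expnS exprM.
Qed.

Section CartierOperator.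
Variables (p : nat) (A : comNzRingType) (chA : p \in [pchar A]) (W : lmodType A).

Definition plinear (e : nat) (M N : lmodType A) (h : M -> N) : Prop :=
  {morph h : x y / x + y} /\ forall a x, h (a ^+ (p ^ e) *: x) = a *: h x.

Lemma plinear_comp d e (M N L : lmodType A) (h : M -> N) (k : N -> L) :
  plinear d h -> plinear e k -> plinear (e + d) (k \o h).
Proof.
move=> [hD hZ] [kD kZ]; split=> [x y|a x] /=; first by rewrite hD kD.
by rewrite expnD exprM hZ kZ.
Qed.

Variable theta : {linear W -> shriek (pFrobenius_aut chA) W}.
Hypothesis theta_bij : bijective theta.

(** The Cartier operator: the map [F_* W -> W] adjoint to [theta]. *)
Definition kappa (w : W) : W := theta w 1.

Lemma thetaZ a w x : theta (a *: w) x = theta w (a * x).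
Proof. by rewrite linearZZ. Qed.

Lemma kappaZ a w : kappa (a *: w) = theta w a.
Proof. by rewrite /kappa thetaZ mulr1. Qed.

Lemma kappa_plinear : plinear 1 kappa.
Proof.
split=> [x y|a x]; first by rewrite /kappa raddfD.
rewrite kappaZ expn1; have := shriekZ (theta x) a 1.
by rewrite mulr1.
Qed.

Lemma iter_kappa_plinear e : plinear e (iter e kappa).
Proof.
elim: e => [|e IH]; first by split=> [//|a x]; rewrite expn0.
exact: (plinear_comp IH kappa_plinear).
Qed.

Lemma iter_kappaZ e a w : iter e kappa (a ^+ (p ^ e) *: w) = a *: iter e kappa w.
Proof. by case: (iter_kappa_plinear e). Qed.

(* [Hom_A(F^e_* M, W) = Hom_A(M, W)], by adjunction and [W = F^! W]. *)
Lemma plinear_factor e (M : lmodType A) (h : M -> W) : plinear e h ->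
  exists l : {linear M -> W}, forall m, h m = iter e kappa (l m).
Proof.
elim: e h => [|e IH] h [hD hZ].
  have [|l lE] := @linear_ext A M W h; last by exists l => m; rewrite lE.
  by move=> a x y; rewrite hD -[in LHS](expr1 a) -(expn0 p) hZ.
have [g thetaK gK] := theta_bij.
(* For fixed [m], the map [r |-> h (r ^+ (p ^ e) *: m)] belongs to [F^! W], hence is [theta w].
   Choosing [w] as the value at [m] strips one Frobenius from [h]. *)
have h1P m : exists w, forall r : A, theta w r = h (r ^+ (p ^ e) *: m).
  pose k (r : A) := h (r ^+ (p ^ e) *: m).
  have kD : {morph k : x y / x + y}.
    by move=> x y; rewrite /k (expr_pXD chA) scalerDl hD.
  have kZ a x : k (pFrobenius_aut chA a * x) = a *: k x.
    by rewrite /k /GRing.pFrobenius_aut exprMn -exprM -expnS -scalerA hZ.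
  by exists (g (@mk_shriek A A (pFrobenius_aut chA) W k kD kZ)) => r; rewrite gK.
have [h1 h1E] := choice h1P.
have h1_inj w w' : (forall r, theta w r = theta w' r) -> w = w'.
  by move=> e1; apply: (can_inj thetaK); apply: shriek_ext.
have [|l lE] := IH h1.
  split=> [x y|a x]; apply: h1_inj => r.
    by rewrite raddfD h1E scalerDr hD -!h1E.
  by rewrite thetaZ !h1E scalerA -exprMn mulrC.
by exists l => m; rewrite iterS -lE /kappa h1E expr1n scale1r.
Qed.

Variable eta : prime_idealr A.
Hypothesis Ffin : F_finite chA.

(** A functional [F_* (A / eta) -> A y] that is nonzero at 1 is [theta y'] for some [y']. It
    vanishes on [eta], so [eta] kills [y']; its value at 1 shows that nothing else does. *)
Lemma kappa_lift_socle (y : W) : is_ann eta y ->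
  exists (y' : W) (c : A), [/\ is_ann eta y', c \notin eta & kappa y' = c *: y].
Proof.
have /fin_gen_generates[s gen_s] := Ffin.
move=> ann_y; have eta_y a : a \in eta -> a *: y = 0 by move/ann_y.
pose FA := pushforward (pFrobenius_aut chA) A^o.
have scaleFA (a : A) (m : FA) : a *: m = a ^+ p * (m : A) :> A by [].
have p_gt0 := prime_gt0 (pcharf_prime chA).
have eta_pow a : (a ^+ p \in eta) = (a \in eta).
  apply/idP/idP => [/prime_idealrX//|aP].
  by rewrite -(prednK p_gt0) exprSr idealMr.
have satK : saturated eta ([set m | (m : A) \in eta] : set FA).
  split; first split=> [|a b aP bP|a b bP]; rewrite /= ?rpred0 //.
  - exact: rpredD.
  - by rewrite scaleFA idealMr.
  by move=> t w tP /=; rewrite scaleFA prime_idealrM eta_pow (negPf tP).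
have [||h [hK hy [c cP h1]]] := exists_functional_at gen_s eta_y satK (m0 := (1 : A)).
- by move=> a m aP; rewrite /= scaleFA mulrC idealMr // eta_pow.
- by rewrite /= idealr1.
have [g thetaK gK] := theta_bij.
pose y' : W := g h; have y'E r : kappa (r *: y') = h r by rewrite kappaZ /y' gK.
exists y', c; split=> //; last by rewrite -h1 -y'E scale1r.
move=> a; split=> [aP|ay'].
  apply: (can_inj thetaK); apply: shriek_ext => r.
  transitivity (0 : W); last by rewrite raddf0.
  apply: etrans (thetaZ a y' r) _; rewrite /y' gK.
  by apply: hK; rewrite /= mulrC idealMr.
have : (a * c) *: y = 0.
  rewrite -scalerA -h1 -[LHS](linearZZ h) -[h _]y'E scaleFA mulr1.
  by rewrite -(prednK p_gt0) exprSr -scalerA ay' scaler0 /kappa raddf0.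
by move/ann_y; rewrite prime_idealrM (negPf cP) orbF.
Qed.

Lemma iter_kappa_lift_socle n (y : W) : is_ann eta y ->
  exists (y' : W) (c : A), [/\ is_ann eta y', c \notin eta & iter n kappa y' = c *: y].
Proof.
move=> ann_y; elim: n => [|n [y1 [c [ann_y1 cP ey1]]]].
  by exists y, 1; rewrite idealr1 scale1r.
have [y2 [d [ann_y2 dP ey2]]] := kappa_lift_socle ann_y1.
have dX k : d ^+ k \notin eta.
  elim: k => [|k IH]; first by rewrite expr0 idealr1.
  by rewrite exprS not_primeM.
(* The factor completes [d] to [d ^+ (p ^ n)] after one [kappa], so that [d] can be pulled out of
   the remaining [n] iterations. *)
exists ((d ^+ (p ^ n).-1) ^+ (p ^ 1) *: y2), (d * c); split.
- by apply: is_annZ; rewrite // -exprM.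
- exact: not_primeM.
have [_ kZ] := kappa_plinear.
rewrite iterSr kZ ey2 scalerA -exprSr prednK ?iter_kappaZ ?ey1 ?scalerA //.
by rewrite expn_gt0 (prime_gt0 (pcharf_prime chA)).
Qed.

Hypothesis fgW : fin_gen W.
Hypothesis endo : forall g : {linear W -> W}, exists a, forall x, g x = a *: x.

(* The socle of [W_eta] is a line: an endomorphism of it that is nonzero on [y]
   lifts along [kappa^e] to multiplication by an element outside [eta]. *)
Lemma iter_kappa_socle e (t : A) (y : W) : is_ann eta y -> t \notin eta ->
    (forall a, a \in eta -> t * a ^+ (p ^ e) = 0) ->
  exists2 c, c \notin eta & forall w, exists d, c *: iter e kappa w = d *: y.
Proof.
move=> ann_y tP nil; have eta_y a : a \in eta -> a *: y = 0 by move/ann_y.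
have [s gen_s] := generates_frob_pow e Ffin fgW.
pose FW := pushforward (frob_pow e chA) W.
have scaleFW (a : A) (m : FW) : a *: m = a ^+ (p ^ e) *: (m : W) :> W by [].
have pe_gt0 : (0 < p ^ e)%N by rewrite expn_gt0 (prime_gt0 (pcharf_prime chA)).
have [kD kZ] := iter_kappa_plinear e.
(* The kernel of [kappa^e] localized at [eta]. By the choice of [t] it contains [eta *: FW], so a
   functional to [A y] can vanish on it and be nonzero at a lift [y'] of the socle. *)
pose K : set FW := [set m | exists2 u, u \notin eta & u *: iter e kappa (m : W) = 0].
have k0 : iter e kappa 0 = 0 by have := kZ 0 0; rewrite scaler0 scale0r.
have satK : saturated eta K.
  split; first split=> [|x y1 [u uP ux] [v vP vy]|a x [u uP ux]].
  - by exists 1; rewrite ?idealr1 ?k0 ?scaler0.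
  - exists (u * v); first exact: not_primeM.
    rewrite kD scalerDr -[in X in _ + X]scalerA vy scaler0 addr0.
    by rewrite mulrC -scalerA ux scaler0.
  - by exists u => //; rewrite scaleFW kZ scalerA mulrC -scalerA ux scaler0.
  move=> u w uP [v vP]; rewrite scaleFW kZ scalerA => vw; exists (v * u) => //.
  exact: not_primeM.
have [y' [c [ann_y' cP ey']]] := iter_kappa_lift_socle e ann_y.
have [||h [_ hy [d dP hy']]] := exists_functional_at gen_s eta_y satK (m0 := y').
- move=> a m aP; exists t => //.
  have ta : t ^+ (p ^ e) * a ^+ (p ^ e) = 0.
    by rewrite -{1}(prednK pe_gt0) exprSr -mulrA nil // mulr0.
  by rewrite scaleFW -kZ scalerA ta scale0r k0.
- move=> [u uP]; rewrite ey' scalerA => /ann_y.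
  by apply/negP/not_primeM.
have [|l lE] := @plinear_factor e W (h : W -> W).
  by split=> [x z|a x]; [exact: (raddfD h) | exact: (linearZZ h)].
have [b lb] := endo l.
have bP : b \notin eta.
  apply/negP => bP; have : d *: y = 0.
    by rewrite -hy' lE lb; have -> : b *: y' = 0 by apply/ann_y'.
  by move/ann_y; apply/negP.
(* [b *: kappa^e w = kappa^e (b *: w') = h w'] with [w' = b ^+ (p ^ e).-1 *: w], and [h] takes
   values in [A y]. *)
exists b => // w; rewrite -kZ -(prednK pe_gt0) exprS -scalerA -lb -lE.
exact: hy.
Qed.

End CartierOperator.

(** * The test condition *)

Section TestCondition.
Variables (A : comNzRingType) (M : lmodType A) (eta : prime_idealr A).
Local Notation fr := (@Defs.frac A (prime_compl eta) M).

Lemma frac_eq0 m s : fr m s = 0 <-> exists2 t, t \notin eta & t *: m = 0.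
Proof.
split=> [/fracP[u uP]|[t tP tm]].
  by rewrite val_denom1 scale1r !scaler0 => um; exists u.
by apply/fracP; exists t => //; rewrite val_denom1 scale1r !scaler0.
Qed.

Lemma H0_frac m s :
  (forall a, a \in eta -> exists2 t, t \notin eta & t *: (a *: m) = 0) ->
  H0 (fr m s).
Proof.
move=> eta_m; exists 1%N => a nu; rewrite big_ord1.
have := nu ord0; have [b [t ->]] := rfracW (a ord0) => /nonunits_rfrac bP.
rewrite [LHS](loc_actE b m t s); apply/frac_eq0; exact: eta_m.
Qed.

Variable p : nat.
Variable C : nat -> set (M -> M).
Hypothesis p_gt0 : (0 < p)%N.
Hypothesis C_cartier : forall e phi, C e phi -> cartier_map p e phi.

(** Each factor from [C_+] has degree at least 1, so [n] of them compose to degree at least [n]; the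
    powers of the denominator are absorbed into the numerator. *)
Lemma iter_Cplus_mul n (X : set (loc_mod_at eta M)) z :
  iter n (@Cplus_mul p A M C eta) X z ->
  exists e phi m s, [/\ (n <= e)%N, cartier_map p e phi & z = fr (phi m) s].
Proof.
elim: n z => [|n IH] z.
  move=> _; have [m [s ->]] := fracW z; by exists 0%N, id, m, s.
move=> [d [psi [_ [d_gt0 /C_cartier psiP /IH[e [phi [m [s [ne phiP ->]]]]] ->]]]].
have [_ phiZ] := phiP.
rewrite loc_cartierE // -phiZ.
exists (d + e)%N, (psi \o phi), ((dval s ^+ (p ^ d).-1) ^+ (p ^ e) *: m), s.
split=> //; last exact: plinear_comp phiP psiP.
by rewrite -add1n leq_add.
Qed.

End TestCondition.

Section AssociatedTest.
Variables (p : nat) (A : comNzRingType) (chA : p \in [pchar A]) (W : lmodType A).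
Hypotheses (noethA : noetherian A) (Ffin : F_finite chA) (cm : cohen_macaulay A).
Hypotheses (can : canonical_module W) (bangW : bang chA W).
Implicit Types (N : set W) (eta : prime_idealr A).

Let p_gt0 : (0 < p)%N := prime_gt0 (pcharf_prime chA).

Lemma associated_nilpotent eta : associated W eta ->
  exists t e, t \notin eta /\ forall a, a \in eta -> t * a ^+ (p ^ e) = 0.
Proof.
move=> /(associated_ring can)[b etab].
exact/(frobenius_nilpotent chA noethA)/dim0_nilpotent/(associated_dim0 cm etab).
Qed.

(* On [H^0_eta] the Cartier operators are not nilpotent, and their images meet
   the socle of [W_eta]. *)
Lemma test_condition_associated N eta :
    test_condition p (fun e => @cartier_map p e A W) N -> associated W eta ->
  exists2 y, N y & is_ann eta y.
Proof.
move=> [[sN _] test] assW; have [theta theta_bij] := bangW.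
have [_ [n sub]] := test eta assW; have [x ann_x] := assW.
have [y [c [ann_y cP ey]]] := iter_kappa_lift_socle theta_bij Ffin n ann_x.
pose d1 := denom1 (prime_compl eta).
have : iter n (@Cplus_mul p A W (fun e => @cartier_map p e A W) eta) (@H0 A W eta)
    (Defs.frac (iter n (kappa theta) y) d1).
  elim: n {sub ey} => [|n IH] /=.
    apply: H0_frac => a /ann_y ->; exists 1; rewrite ?idealr1 //.
    by rewrite scaler0.
  have kP : cartier_map p 1 (kappa theta) by apply: kappa_plinear.
  exists 1%N, (kappa theta), (Defs.frac (iter n (kappa theta) y) d1); split=> //.
  by rewrite loc_cartierE // val_denom1 expr1n scale1r.
(* At [eta] the socle element [c *: y] equals a fraction [m / s] with [m] in [N]; clearing
   denominators, [u *: m] is a multiple of [y] by elements outside [eta]. *)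
move/sub => [[m [s [Nm]]] + _].
rewrite ey => /fracP[u uP]; rewrite val_denom1 scale1r => e.
exists (u *: m); first by case: sN => _ _; apply.
have sP : dval s \notin eta := denomP s.
by rewrite -e; do 3! [apply: is_annZ => //].
Qed.

(** Cartier operators of degree at least [e] factor through [kappa^e], whose image at [eta] lies in
    the line of [y], hence in [N]. Thus the [e]-th power of [C_+] kills the cokernel. *)
Lemma associated_test_condition N :
    cartier_submodule (fun e => @cartier_map p e A W) N ->
    (forall eta, associated W eta -> exists2 y, N y & is_ann eta y) ->
  test_condition p (fun e => @cartier_map p e A W) N.
Proof.
move=> cN assN; split=> // eta assW.
have [t [e [tP nil]]] := associated_nilpotent assW.
have [[N0 ND NZ] _] := cN.
have [y Ny ann_y] := assN eta assW.
have [theta theta_bij] := bangW; have [fgW _ _ endo _] := can.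
have [c cP socle] := iter_kappa_socle theta_bij Ffin fgW endo ann_y tP nil.
split=> [x []//|]; exists e => z /iter_Cplus_mul[//|//|d [phi [m [s [ed phiP ->]]]]].
have [l lE] := plinear_factor theta_bij phiP.
have [b eb] := socle (iter (d - e) (kappa theta) (l m)).
rewrite -iterD subnKC // -lE in eb.
pose cs := denomM (mk_denom (W := prime_compl eta) cP) s.
have -> : Defs.frac (phi m) s = Defs.frac (b *: y) cs :> loc_mod_at eta W.
  by apply: frac_cancel; rewrite -eb val_denomM scalerA mulrC.
split; first by exists (b *: y), cs; split=> //; apply: NZ.
apply: H0_frac => a /ann_y ay; exists 1; rewrite ?idealr1 //.
by rewrite scale1r scalerA mulrC -scalerA ay scaler0.
Qed.

End AssociatedTest.

(** * The trace of a finite morphism *)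

Section Trace.
Variables (p : nat) (R S : comNzRingType).
Variables (chR : p \in [pchar R]) (chS : p \in [pchar S]).
Variables (f : {rmorphism R -> S}) (omega : lmodType R).
Hypothesis finf : finite_morphism f.
Local Notation omegaS := (shriek f omega).
Local Notation CR := (fun e => @cartier_map p e R omega).
Local Notation CS := (fun e => @cartier_map p e S omegaS).

Lemma shriek_scaleE (s : S) (g : omegaS) b : shriek_fun (s *: g) b = g (s * b).
Proof. by []. Qed.

Lemma contraction_prime (q : prime_idealr S) :
  exists eta : prime_idealr R, forall a, a \in eta <-> f a \in q.
Proof.
apply: (@prime_idealr_of_set R [set a | f a \in q]) => [||a b] /=.
- split=> [|a b aq bq|a b bq]; rewrite /= ?rmorph0 ?rmorphD ?rmorphM ?rpred0 //.
  + exact: rpredD.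
  + exact: idealMr.
- by rewrite rmorph1 idealr1.
- by rewrite rmorphM prime_idealrM => /orP.
Qed.

(** [f a] kills [g] exactly when [a] kills all values of [g], and [S] is finite over [R], so one
    value already has annihilator [eta]. *)
Lemma is_ann_shriek_value (q : prime_idealr S) (eta : prime_idealr R) (g : omegaS) :
    (forall a, a \in eta <-> f a \in q) -> is_ann q g ->
  exists b, is_ann eta (g b).
Proof.
have /fin_gen_generates[s gen_s] := finf.
move=> etaq ann_g.
apply: (is_ann_value (g := g : {linear pushforward f S^o -> omega}) gen_s).
move=> a; split=> [/etaq/ann_g ag b|ag].
  by rewrite -[LHS](shriekZ g a b) -shriek_scaleE ag.
apply/etaq/ann_g/shriek_ext => b.
by rewrite shriek_scaleE shriekZ; apply: ag.
Qed.

(** The lift is [phi^!], sending [g] to [s |-> phi (g (s ^+ (p ^ e)))]; for [kappa_R] this is the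
    formula of [kappa_S]. *)
Lemma shriek_cartier e (phi : omega -> omega) : cartier_map p e phi ->
  exists2 psi : omegaS -> omegaS, cartier_map p e psi &
    forall g, Tr (psi g) = phi (Tr g).
Proof.
move=> [phiD phiZ].
pose k (g : omegaS) (s : S) := phi (g (s ^+ (p ^ e))).
have kD g : {morph k g : x y / x + y}.
  by move=> x y; rewrite /k (expr_pXD chS) shriekD phiD.
have kZ g a x : k g (f a * x) = a *: k g x.
  by rewrite /k exprMn -rmorphXn shriekZ phiZ.
exists (fun g => @mk_shriek R S f omega (k g) (kD g) (kZ g)); last first.
  by move=> g; rewrite /Tr -[LHS]/(k g 1) /k expr1n.
split=> [g h|s g]; apply: shriek_ext => x.
  exact: phiD.
rewrite -[LHS]/(phi (g (s ^+ (p ^ e) * x ^+ (p ^ e)))) -exprMn.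
by [].
Qed.

Lemma Tr_cartier_submodule (N : set omegaS) :
  cartier_submodule CS N -> cartier_submodule CR (@Tr R S f omega @` N).
Proof.
move=> [[N0 ND NZ] NC]; split; first split.
- by exists 0.
- by move=> _ _ [g Ng <-] [h Nh <-]; exists (g + h) => //; apply: ND.
- move=> a _ [g Ng <-]; exists (f a *: g); first exact: NZ.
  by rewrite /Tr shriek_scaleE shriekZ.
move=> e phi _ e_gt0 /shriek_cartier[psi psiP psiE] [g Ng <-].
by exists (psi g); [apply: NC psiP Ng | rewrite psiE].
Qed.

Hypotheses (noethR : noetherian R) (noethS : noetherian S).
Hypotheses (FfinR : F_finite chR) (FfinS : F_finite chS).
Hypotheses (cmR : cohen_macaulay R) (cmS : cohen_macaulay S).
Hypotheses (canR : canonical_module omega) (canS : canonical_module omegaS).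
Hypotheses (bangR : bang chR omega) (bangS : bang chS omegaS).

(* An associated prime [eta] of [omega] is the contraction of an associated prime
   of the maps [S -> R / eta -> omega]. *)
Lemma Tr_test_condition (N : set omegaS) : dominant f ->
    cartier_submodule CS N ->
    (forall q, associated omegaS q -> exists2 g, N g & is_ann q g) ->
  test_condition p CR (@Tr R S f omega @` N).
Proof.
move=> domf cN assN.
apply: (associated_test_condition noethR FfinR cmR canR bangR).
  exact: Tr_cartier_submodule.
move=> eta [x ann_x]; have eta_x a : a \in eta -> a *: x = 0 by move/ann_x.
have /fin_gen_generates[s gen_s] := finf.
have satK := @saturated_torsion R (pushforward f S^o) eta.
(* Dominance makes the [eta]-torsion of [S] proper: a [t] outside [eta] killing 1 would map to 0,
   which lies in every prime of [S]. *)
have [|h [m0 [_ hx [c cP hm0]]]] := exists_functional gen_s eta_x satK.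
  move/(_ (1 : S)) => [t tP]; rewrite -[_ *: _]/(f t * 1) mulr1 => ft0.
  have [|Q] := domf t; first by exists eta.
  by rewrite ft0 idealr0.
pose g : omegaS := h.
have g0 : g != 0.
  apply/eqP => /(congr1 (fun k : omegaS => k m0)).
  by rewrite -[LHS]/(h m0) hm0 => /ann_x; apply/negP.
have [q [u qP]] := exists_prime_ann noethS g0.
have gx b : exists d, g b = d *: x by exact: hx b.
have etaq a : a \in eta <-> f a \in q.
  rewrite qP; split=> [aP|ag].
    apply: shriek_ext => b; rewrite !shriek_scaleE mulrCA shriekZ.
    by have [d ->] := gx (u * b); rewrite scalerA mulrC -scalerA eta_x ?scaler0.
  (* All values of [g] are multiples of [x]; an [a] outside [eta] that kills such a multiple forces
     it to vanish, so [u *: g] would be 0. *)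
  apply: contrapT => /negP aP; suff : 1 \in q by rewrite idealr1.
  apply/qP; rewrite scale1r; apply: shriek_ext => b; rewrite shriek_scaleE.
  have [d gd] := gx (u * b); rewrite gd.
  apply/ann_x; have : (a * d) *: x = 0.
    by rewrite -scalerA -gd -shriekZ mulrCA -!shriek_scaleE ag.
  by move/ann_x; rewrite prime_idealrM (negPf aP).
have [|k Nk ann_k] := assN q; first by exists (u *: g).
have [b ann_b] := is_ann_shriek_value etaq ann_k.
exists (k b) => //; exists (b *: k); first by case: cN => [[_ _ NZ] _]; apply: NZ.
by rewrite /Tr shriek_scaleE mulr1.
Qed.

(* [f^! N], as a submodule of [f^! omega]. *)
Definition shriek_sub (N : set omega) : set omegaS := [set g | forall b, N (g b)].

(* Every Cartier operator of [omegaS] is [kappa_S^e t] with [t] in [S]. *)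
Lemma shriek_sub_cartier (N : set omega) :
  cartier_submodule CR N -> cartier_submodule CS (shriek_sub N).
Proof.
move=> [[N0 ND NZ] NC]; split.
  by split=> [b|g h Ng Nh b|s g Ng b]; [exact: N0 | exact: ND | exact: Ng].
move=> e psi g e_gt0 [psiD psiZ] Ng b.
have [theta theta_bij] := bangR.
have [|l lE] := @plinear_factor p R chR omega theta theta_bij e
    (pushforward f omegaS) (fun g => Tr (psi g)).
  split=> [x y|a x]; first by rewrite psiD.
  rewrite -[X in psi X]/(f (a ^+ (p ^ e)) *: (x : omegaS)) rmorphXn psiZ.
  by rewrite /Tr shriek_scaleE shriekZ.
(* By adjunction [l] corresponds to the [S]-endomorphism of [omegaS] sending [h] to
   [s |-> l (s *: h)]. This is multiplication by some [t], so [l] is evaluation at [t]. *)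
pose k (h : omegaS) (s : S) := l (s *: h).
have kD h : {morph k h : x y / x + y}.
  by move=> x y; rewrite /k scalerDl; apply: raddfD.
have kZ h a x : k h (f a * x) = a *: k h x.
  by rewrite /k -scalerA; apply: (linearZZ l a (x *: h)).
have [a x y|L LE] := @linear_ext S omegaS omegaS
    (fun h => @mk_shriek R S f omega (k h) (kD h) (kZ h)).
  apply: shriek_ext => z; rewrite -[LHS]/(l (z *: (a *: x + y))).
  rewrite scalerDr scalerA [z * a]mulrC; exact: (raddfD l).
have [_ _ _ endo _] := canS; have [t tL] := endo L.
have lt (h : omegaS) : l h = h t.
  have -> : h t = shriek_fun (t *: h) 1 by rewrite shriek_scaleE mulr1.
  rewrite -tL LE.
  by rewrite -[RHS]/(l (1 *: h)) scale1r.
suff : N (iter e (kappa theta) (g (b ^+ (p ^ e) * t))).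
  suff <- : shriek_fun (psi g) b = iter e (kappa theta) (g (b ^+ (p ^ e) * t)) by [].
  have -> : shriek_fun (psi g) b = Tr (psi (b ^+ (p ^ e) *: g)).
    by rewrite psiZ /Tr shriek_scaleE mulr1.
  by rewrite lE lt shriek_scaleE.
apply: (NC e (iter e (kappa theta))) => //; last exact: Ng.
exact: iter_kappa_plinear.
Qed.

(** A nonzero functional [S / q -> R y] with [y] in [N] lies in [f^! N]. One of its multiples has a
    prime annihilator [q'] containing [q], and [q' = q] because associated primes of [omegaS] are
    minimal. *)
Lemma shriek_sub_test_condition (N : set omega) :
  test_condition p CR N -> test_condition p CS (shriek_sub N).
Proof.
move=> testN; have [cN _] := testN; have [[_ _ NZ] _] := cN.
have cSN := shriek_sub_cartier cN.
apply: (associated_test_condition noethS FfinS cmS canS bangS) => // q [g ann_g].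
have [eta etaq] := contraction_prime q.
have [b ann_b] := is_ann_shriek_value etaq ann_g.
have [|y Ny ann_y] := test_condition_associated FfinR bangR testN (eta := eta).
  by exists (g b).
have /fin_gen_generates[s gen_s] := finf.
have eta_y a : a \in eta -> a *: y = 0 by move/ann_y.
have satq : saturated eta ([set b | (b : S) \in q] : set (pushforward f S^o)).
  split; first split=> [|x z xq zq|a x xq]; rewrite /= ?rpred0 //.
  - exact: rpredD.
  - exact: idealMr.
  move=> t w tP /=; rewrite -[_ *: _]/(f t * w) prime_idealrM.
  by move=> /orP[/etaq|//]; rewrite (negPf tP).
have [||h [hq hy [c cP h1]]] := exists_functional_at gen_s eta_y satq (m0 := (1 : S)).
- by move=> a m /etaq aq; rewrite /= -[_ *: _]/(f a * m) mulrC idealMr.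
- by rewrite /= idealr1.
pose k : omegaS := h.
have Nk : shriek_sub N k by move=> d; have [a] := hy d; rewrite -/(k d) => ->; apply: NZ.
have k0 : k != 0.
  apply/eqP => /(congr1 (fun k : omegaS => k 1)).
  by rewrite -[LHS]/(h 1) h1 => /ann_y; apply/negP.
have [q' [u q'P]] := exists_prime_ann noethS k0.
have qq' d : d \in q -> d \in q'.
  move=> dq; apply/q'P/shriek_ext => z; rewrite !shriek_scaleE.
  by apply: hq; rewrite /= mulrCA mulrC idealMr.
have [|t [e [tP nil]]] := associated_nilpotent chS noethS cmS canS (eta := q').
  by exists (u *: k).
have uk : shriek_sub N (u *: k) by case: cSN => [[_ _ SZ] _]; apply: SZ.
exists (u *: k) => // d; rewrite -q'P; split=> [/qq'//|/nil td].
(* Minimality of [q'] in the form of nilpotence: the product is 0, and [t] is outside [q] since it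
   is outside [q']. *)
have : t * d ^+ (p ^ e) \in q by rewrite td idealr0.
rewrite prime_idealrM => /orP[/qq'|/prime_idealrX//].
by rewrite (negPf tP).
Qed.

End Trace.

Theorem corollary5p6
  (p : nat) (R S : comNzRingType)
  (chR : p \in [pchar R]) (chS : p \in [pchar S])
  (noethR : noetherian R) (noethS : noetherian S)
  (FfinR : F_finite chR) (FfinS : F_finite chS)
  (cmR : cohen_macaulay R) (cmS : cohen_macaulay S)
  (G1R : gorenstein_codim1 R) (G1S : gorenstein_codim1 S)
  (S2R : serre_S 2 R) (S2S : serre_S 2 S)
  (f : {rmorphism R -> S})
  (finf : finite_morphism f) (domf : dominant f)
  (omegaR : lmodType R)
  (canR : canonical_module omegaR)
  (canS : canonical_module (shriek f omegaR))
  (bangR : bang chR omegaR) (bangS : bang chS (shriek f omegaR))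
  (T : shriek f R^o) (genT : generic_iso T) :
  [/\ forall tauS : set (shriek f omegaR),
        is_tau p tauS -> is_tau p (@Tr R S f omegaR @` tauS),
      F_rational p omegaR ->
        forall w : omegaR, exists g : shriek f omegaR, Tr g = w
    & (forall w : omegaR, exists g : shriek f omegaR, Tr g = w) ->
        F_rational p (shriek f omegaR) -> F_rational p omegaR].
Proof.
have tau (tauS : set (shriek f omegaR)) :
    is_tau p tauS -> is_tau p (@Tr R S f omegaR @` tauS).
  move=> [testS minS]; split.
    apply: (Tr_test_condition chS) => //; first by case: testS.
    by move=> q assq; apply: test_condition_associated testS assq.
  move=> N testN _ [g tau_g <-].
  have testN' := shriek_sub_test_condition finf noethS FfinR FfinS cmS canS
    bangR bangS testN.
  (* Membership in [f^! N], evaluated at 1, is membership of the trace in [N]. *)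
  exact: (minS _ testN' g tau_g 1).
split=> // [[_ minR] w|surj /tau].
  (* All of [omegaS] contains every required annihilator witness, so its trace image passes the test
     and contains [tau(omega)], which is [omega]. *)
  have [||g _ gw] := minR (@Tr R S f omegaR @` setT) _ w; last by exists g.
    apply: (Tr_test_condition chS) => //.
    by move=> q [g ann_g]; exists g.
  by [].
rewrite /F_rational; suff -> : @Tr R S f omegaR @` setT = setT by [].
by apply/seteqP; split=> // w _; have [g <-] := surj w; exists g.
Qed.
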